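(* Let $\mathbf i=(i_1,\dots,i_N)$ and $\mathbf i'=(i'_1,\dots,i'_N)$ be reduced expressions of $w_0$ related by a braid move: there are $1\le k\le N-2$ and $p,q\in I$ with $p\cdot q=-1$ such that $i_k=i_{k+2}=p$, $i_{k+1}=q$, $i'_k=i'_{k+2}=q$, $i'_{k+1}=p$ and $i'_j=i_j$ for $j\notin\{k,k+1,k+2\}$. Assume the standard seed $\mathcal S^{\mathbf i}$ with cluster variables $x_1,\dots,x_N$ satisfies: (A) for every $1\le j\le N$, $\overline D(x_j)=1/P_j$ with $P_j$ a product of positive roots; (B) for every $1\le j\le N$, $P_jP_{j_-(\mathbf i)}=\beta_j\prod_{l<j<l_+(\mathbf i),\ i_l\cdot i_j=-1}P_l$, with $P_0:=1$; (C) for every $j\in J_{ex}(\mathbf i)$ and every $1\le i\le N$, $(\beta_i;P_j)-(\beta_i;P_{j_+(\mathbf i)})\le1$. Then the cluster variables $x'_1,\dots,x'_N$ of $\mathcal S^{\mathbf i'}$ satisfy the analogous properties (A), (B), (C) with respect to $\mathbf i'$ (with $\beta'_j$, $j_\pm(\mathbf i')$, $J_{ex}(\mathbf i')$ and polynomials $P'_j:=(\overline D(x'_j))^{-1}$).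
   Context: $\mathfrak g$ is a finite-dimensional complex simple Lie algebra of simply-laced type, Dynkin vertex set $I=\{1,\dots,n\}$, $i\cdot j$ the Cartan matrix entries ($i\cdot i=2$, $-1$ for adjacent vertices, $0$ otherwise), Weyl group $W$ with simple reflections $s_i$, longest element $w_0$, $N:=\ell(w_0)$, positive roots $\Phi_+$, fundamental weights $\omega_i$. $\mathsf N$ is the unipotent radical of a Borel subgroup of the simply connected group of $\mathfrak g$, $\mathfrak n$ its Lie algebra with Chevalley generators $e_i$, and $\mathbb C[\mathsf N]$ is identified with the graded dual of $U(\mathfrak n)$ via a pairing $(\cdot,\cdot)$. With $\alpha_1,\dots,\alpha_n$ indeterminates, $\overline D:\mathbb C[\mathsf N]\to\mathbb C(\alpha_1,\dots,\alpha_n)$ is the algebra morphism $\overline D(f)=\sum_{\mathbf j=(j_1,\dots,j_r)}(f,e_{j_1}\cdots e_{j_r})\big(\alpha_{j_1}(\alpha_{j_1}+\alpha_{j_2})\cdots(\alpha_{j_1}+\dots+\alpha_{j_r})\big)^{-1}$. A positive root $\sum a_i\alpha_i$ is viewed as a linear form in the $\alpha_i$; a ''product of positive roots'' is a finite product of such forms, with repetitions allowed; $(\beta;P)$ is the multiplicity of $\beta$ as a factor of $P$. For a reduced expression $\mathbf i$ of $w_0$: $\beta_j:=s_{i_1}\cdots s_{i_{j-1}}(\alpha_{i_j})$; $j_-(\mathbf i):=\max(\{l<j:i_l=i_j\}\cup\{0\})$, $j_+(\mathbf i):=\min(\{l>j:i_l=i_j\}\cup\{N+1\})$; $J_{ex}(\mathbf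 i):=\{j: j_+(\mathbf i)\le N\}$. The standard seed $\mathcal S^{\mathbf i}$ (Geiss–Leclerc–Schröer) has cluster variables the flag minors $x_j=D(s_{i_1}\cdots s_{i_j}\omega_{i_j},\omega_{i_j})$, $D(u\lambda,v\lambda)$ denoting the unipotent minor. *)

(* Defs.v *)
From HB Require Import structures.
From mathcomp Require Import all_boot all_order all_algebra all_field.
From mathcomp Require Import fraction.
From mathcomp Require Import mpoly.

Set Implicit Arguments.
Unset Strict Implicit.
Unset Printing Implicit Defensive.

Import Order.TTheory GRing.Theory Num.Theory.
Local Open Scope ring_scope.

(* Throughout, the rank is  r = n.+1 >= 1, the Dynkin vertex set is I = 'I_n.+1,
   and  C : 'M[int]_n.+1  is the Cartan matrix  C i j = i . j. *)

Definition simply_laced_simple_cartan (n : nat) (C : 'M[int]_n.+1) : Prop :=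
  [/\ (forall i, C i i = 2),
      (forall i j, i != j -> C i j = 0 \/ C i j = -1),
      (forall i j, C i j = C j i),
      (* finite type: the symmetric Cartan matrix is positive definite *)
      (forall v : 'rV[rat]_n.+1, v != 0 ->
          0 < (v *m map_mx (fun z : int => z%:~R) C *m v^T) 0 0) &
      (* simple: the Dynkin diagram is connected *)
      (forall S : {set 'I_n.+1}, S != set0 -> S != setT ->
          exists i j, [/\ i \in S, j \notin S & C i j != 0])].

(** Root lattice (coordinates on simple roots) and weight lattice
    (coordinates on fundamental weights). *)
Definition rootv (n : nat) := {ffun 'I_n.+1 -> int}.
Definition weightv (n : nat) := {ffun 'I_n.+1 -> int}.

Definition simple_root (n : nat) (i : 'I_n.+1) : rootv n := [ffun j => (j == i)%:Z].
Definition fund_weight (n : nat) (i : 'I_n.+1) : weightv n := [ffun j => (j == i)%:Z].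

Definition rpair (n : nat) (C : 'M[int]_n.+1) (b : rootv n) (i : 'I_n.+1) : int :=
  \sum_k b k * C k i.

Definition sref (n : nat) (C : 'M[int]_n.+1) (i : 'I_n.+1) (b : rootv n) : rootv n :=
  [ffun j => b j - (j == i)%:Z * rpair C b i].
Definition wref (n : nat) (C : 'M[int]_n.+1) (i : 'I_n.+1) (l : weightv n) : weightv n :=
  [ffun j => l j - l i * C i j].

Definition ract (n : nat) (C : 'M[int]_n.+1) (s : seq 'I_n.+1) (b : rootv n) : rootv n :=
  foldr (sref C) b s.
Definition wact (n : nat) (C : 'M[int]_n.+1) (s : seq 'I_n.+1) (l : weightv n) : weightv n :=
  foldr (wref C) l s.

(** Weyl group elements are words modulo equality of their (faithful) action
    on the weight lattice. *)
Definition same_elt (n : nat) (C : 'M[int]_n.+1) (s t : seq 'I_n.+1) : Prop :=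
  forall l : weightv n, wact C s l = wact C t l.

Definition reduced_word (n : nat) (C : 'M[int]_n.+1) (s : seq 'I_n.+1) : Prop :=
  forall t, same_elt C s t -> (size s <= size t)%N.

Definition red_expr_w0 (n : nat) (C : 'M[int]_n.+1) (s : seq 'I_n.+1) : Prop :=
  reduced_word C s /\ (forall t, reduced_word C t -> (size t <= size s)%N).

Definition is_posroot (n : nat) (C : 'M[int]_n.+1) (b : rootv n) : Prop :=
  (exists (s : seq 'I_n.+1) (i : 'I_n.+1), ract C s (simple_root i) = b) /\
  (forall j, 0 <= b j).

(** Positions in a word are 1-indexed as in the paper. *)
Definition letter (n : nat) (w : seq 'I_n.+1) (j : nat) : 'I_n.+1 := nth ord0 w j.-1.

Definition beta (n : nat) (C : 'M[int]_n.+1) (w : seq 'I_n.+1) (j : nat) : rootv n :=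
  ract C (take j.-1 w) (simple_root (letter w j)).

Definition jminus (n : nat) (w : seq 'I_n.+1) (j : nat) : nat :=
  \max_(1 <= l < j | letter w l == letter w j) l.

(* j_+ = min ({l > j : i_l = i_j} U {N+1}),  N = size w *)
Definition jplus (n : nat) (w : seq 'I_n.+1) (j : nat) : nat :=
  (j + 1 + find (pred1 (letter w j)) (drop j w))%N.

Definition in_Jex (n : nat) (w : seq 'I_n.+1) (j : nat) : bool :=
  (1 <= j)%N && (j <= size w)%N && (jplus w j <= size w)%N.

(** * Matrix coefficients  <v_lambda^*, e_{j_r} ... e_{j_1} f_{k_1} ... f_{k_m} v_lambda>
    computed in the Verma module of highest weight lambda (they coincide with
    those in the irreducible module V(lambda)). *)

(* e_i . (f_{k_1} ... f_{k_m} v_lambda) as a formal combination of f-words *)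
Fixpoint eact (n : nat) (C : 'M[int]_n.+1) (l : weightv n) (i : 'I_n.+1)
    (K : seq 'I_n.+1) : seq (int * seq 'I_n.+1) :=
  match K with
  | [::] => [::]
  | k :: K' =>
      [seq (p.1, k :: p.2) | p <- eact C l i K'] ++
      (if k == i then [:: (l i - \sum_(s <- K') C s i, K')] else [::])
  end.

(* mc C l J K = <v_l^*, e_{j_r} ... e_{j_1} f_K v_l>  for J = [:: j_1; ..; j_r]
   (e_{j_1} is applied first) *)
Fixpoint mc (n : nat) (C : 'M[int]_n.+1) (l : weightv n) (J : seq 'I_n.+1)
    (K : seq 'I_n.+1) : int :=
  match J with
  | [::] => (K == [::])%:Z
  | i :: J' => \sum_(p <- eact C l i K) p.1 * mc C l J' p.2
  end.

(* extremal vector v_{w lambda} = f_{k_1}^{(a_1)} ... f_{k_m}^{(a_m)} v_lambda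
   for w = s_{k_1} ... s_{k_m},  a_t = <s_{k_{t+1}} ... s_{k_m} lambda, alpha_{k_t}^vee> *)
Fixpoint fdata (n : nat) (C : 'M[int]_n.+1) (s : seq 'I_n.+1) (l : weightv n)
    : seq (nat * 'I_n.+1) :=
  match s with
  | [::] => [::]
  | k :: s' => (absz (wact C s' l k), k) :: fdata C s' l
  end.

Definition fword (n : nat) (C : 'M[int]_n.+1) (s : seq 'I_n.+1) (l : weightv n)
    : seq 'I_n.+1 :=
  flatten [seq nseq p.1 p.2 | p <- fdata C s l].

(* (D(w lambda, lambda), e_{j_1} ... e_{j_r}) for w given by the word s *)
Definition minor_coef (n : nat) (C : 'M[int]_n.+1) (s : seq 'I_n.+1) (l : weightv n)
    (J : seq 'I_n.+1) : algC :=
  (mc C l J (fword C s l))%:~R / (\prod_(p <- fdata C s l) p.1`!)%:R.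

Definition polyA (n : nat) := {mpoly algC[n.+1]}.
Definition fracA (n : nat) := {fraction {mpoly algC[n.+1]}}.

Definition tofracA (n : nat) (x : polyA n) : fracA n := @FracField.tofrac _ x.

Definition Dden (n : nat) (J : seq 'I_n.+1) : polyA n :=
  \prod_(t < size J) \sum_(u < t.+1) 'X_(nth ord0 J u).

(* Dbar(D(w lambda, lambda)); only words J of length = size (fword ..) pair
   nontrivially with this homogeneous element, so the sum is over those. *)
Definition Dbar_minor (n : nat) (C : 'M[int]_n.+1) (s : seq 'I_n.+1) (l : weightv n)
    : fracA n :=
  \sum_(J : (size (fword C s l)).-tuple 'I_n.+1)
     tofracA ((minor_coef C s l J)%:MP) / tofracA (Dden J).

(* Dbar of the cluster variable x_j = D(s_{i_1} ... s_{i_j} omega_{i_j}, omega_{i_j})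
   of the standard seed S^w *)
Definition Dbar_x (n : nat) (C : 'M[int]_n.+1) (w : seq 'I_n.+1) (j : nat) : fracA n :=
  Dbar_minor C (take j w) (fund_weight (letter w j)).

Definition rootpoly (n : nat) (b : rootv n) : polyA n := \sum_k (b k)%:~R *: 'X_k.

(* a product of positive roots, given by the list of its factors (with repetitions);
   the multiplicity (beta; P) is the number of occurrences of beta in the list *)
Definition prodroots (n : nat) (m : seq (rootv n)) : polyA n := \prod_(b <- m) rootpoly b.

Definition Pj (n : nat) (m : nat -> seq (rootv n)) (j : nat) : polyA n :=
  if j == 0%N then 1 else prodroots (m j).

Definition propA (n : nat) (C : 'M[int]_n.+1) (w : seq 'I_n.+1) (m : nat -> seq (rootv n)) :=
  forall j, (1 <= j <= size w)%N ->
    (forall b, b \in m j -> is_posroot C b) /\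
    Dbar_x C w j = (tofracA (prodroots (m j)))^-1.

Definition propB (n : nat) (C : 'M[int]_n.+1) (w : seq 'I_n.+1) (m : nat -> seq (rootv n)) :=
  forall j, (1 <= j <= size w)%N ->
    Pj m j * Pj m (jminus w j) =
    rootpoly (beta C w j) *
      \prod_(1 <= l < j | (j < jplus w l)%N && (C (letter w l) (letter w j) == -1)) Pj m l.

Definition propC (n : nat) (C : 'M[int]_n.+1) (w : seq 'I_n.+1) (m : nat -> seq (rootv n)) :=
  forall j i, in_Jex w j -> (1 <= i <= size w)%N ->
    (count_mem (beta C w i) (m j))%:Z - (count_mem (beta C w i) (m (jplus w j)))%:Z <= 1.

Definition braid_move (n : nat) (C : 'M[int]_n.+1) (w w' : seq 'I_n.+1) (k : nat)
    (p q : 'I_n.+1) : Prop :=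
  [/\ size w' = size w, (1 <= k <= size w - 2)%N & C p q = -1] /\
  [/\ letter w k = p, letter w k.+1 = q & letter w k.+2 = p] /\
  [/\ letter w' k = q, letter w' k.+1 = p & letter w' k.+2 = q] /\
  (forall j, (1 <= j <= size w)%N -> j \notin [:: k; k.+1; k.+2] ->
     letter w' j = letter w j).

(* Main.v *)
Require Import Defs.
From HB Require Import structures.
From mathcomp Require Import all_boot all_order all_algebra all_field.
From mathcomp Require Import boolp functions.
From mathcomp Require Import zify ring.
From mathcomp Require Import fraction.
From mathcomp Require Import mpoly.

(** In the coinduced module of functions on words, where [e_i] strips the first letter,
    the unipotent minor [D(s l, l)] is the extremal vector [Phi l s] itself.  Leibniz rules
    for the shuffle product lift the trivial identity
    [f_p * f_q = f_p f_q + f_q f_p] (on vacuum vectors) by divided powers to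
    [D(v s_p om_p) D(v s_q om_q) = D(v om_p) D(v s_p s_q om_q) + D(v s_q s_p om_p) D(v om_q)]
    for fundamental weights [om_p], [om_q],
    and [Dbar] is multiplicative for the shuffle product.  Substituting (A) and (B) for [w]
    determines the value of the only new cluster variable,
    [P'_k = beta_k P_(k+2) Q_q / (beta_(k+1) P_k)], where [Q_r] belongs to the last occurrence
    of the letter [r] before position [k]; the two other variables at the braid are swapped.
    By unique factorization everything else is a computation with multiplicities of roots:
    (C) forces the exponents of [P'_k] to be nonnegative. *)

Set Implicit Arguments.
Unset Strict Implicit.
Unset Printing Implicit Defensive.

Import Order.TTheory GRing.Theory Num.Theory.
Local Open Scope ring_scope.

(** * Roots and reduced words *)

Section Weyl.
Variables (n : nat) (C : 'M[int]_n.+1).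
Implicit Types (i j k : 'I_n.+1) (s t u : seq 'I_n.+1) (b c : rootv n) (l : weightv n).

(** Minors are defined from formal words, so neither their invariance under a braid move nor the
    vanishing of raising operators on extremal vectors comes for free. The coinduced module yields
    both without constructing irreducible modules: a function that is zero at the empty word and
    killed by every [eop k] is zero, so vectors that would be singular in a Verma module vanish.
    Hence the lowering operators satisfy the Serre relations, and for dominant [l] the vacuum is
    integrable. Braid invariance becomes Verma's rank two identity, and sl2 theory gives the
    vanishing that leaves a single term in the Leibniz rule. The sum of two reciprocals is again a
    reciprocal because [beta_(k+1) = beta_k + beta_(k+2)]: by (B), over a common denominator the two
    numerators are [beta_(k+2)] and [beta_k]. Divisibility is then checked one root at a time. The
    [beta_i] are distinct and [P_j] involves only [beta_1, ..., beta_j], so each root falls into one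
    of four cases of linear arithmetic. *)

Lemma simple_rootE i j : simple_root i j = (j == i)%:Z.
Proof. by rewrite ffunE. Qed.

Lemma srefE i b j : sref C i b j = b j - (j == i)%:Z * rpair C b i.
Proof. by rewrite ffunE. Qed.

Lemma wrefE i l j : wref C i l j = l j - l i * C i j.
Proof. by rewrite ffunE. Qed.

Lemma rpairD b c i : rpair C (b + c) i = rpair C b i + rpair C c i.
Proof.
by rewrite /rpair -big_split; apply: eq_bigr => k _; rewrite ffunE mulrDl.
Qed.

Lemma rpairN b i : rpair C (- b) i = - rpair C b i.
Proof.
by rewrite /rpair -sumrN; apply: eq_bigr => k _; rewrite ffunE mulNr.
Qed.

Lemma srefD i b c : sref C i (b + c) = sref C i b + sref C i c.
Proof. by apply/ffunP => j; rewrite !(srefE, ffunE) rpairD; ring. Qed.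

Lemma ractD s b c : ract C s (b + c) = ract C s b + ract C s c.
Proof. by elim: s => //= i s ->; rewrite srefD. Qed.

Lemma ract_cat s t b : ract C (s ++ t) b = ract C s (ract C t b).
Proof. by rewrite /ract foldr_cat. Qed.

Lemma wact_cat s t l : wact C (s ++ t) l = wact C s (wact C t l).
Proof. by rewrite /wact foldr_cat. Qed.

Lemma rpair_simple i j : rpair C (simple_root i) j = C i j.
Proof.
rewrite /rpair (bigD1 i) //= simple_rootE eqxx mul1r big1 ?addr0 // => k ki.
by rewrite simple_rootE (negPf ki) mul0r.
Qed.

Lemma rpair_sref i b j : rpair C (sref C i b) j = rpair C b j - rpair C b i * C i j.
Proof.
rewrite /rpair (eq_bigr (fun k => b k * C k j - (k == i)%:Z * rpair C b i * C k j)).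
  rewrite big_split sumrN /=; congr (_ - _); rewrite (bigD1 i) //= eqxx mul1r.
  by rewrite big1 ?addr0 // => k /negPf ->; rewrite !mul0r.
by move=> k _; rewrite srefE mulrBl.
Qed.

(** Fundamental weights and simple roots are dual bases here: in simply-laced type, roots and
    coroots are identified. *)
Definition wpair l b : int := \sum_k l k * b k.

Lemma wpair_simple l i : wpair l (simple_root i) = l i.
Proof.
rewrite /wpair (bigD1 i) //= simple_rootE eqxx mulr1 big1 ?addr0 // => k ki.
by rewrite simple_rootE (negPf ki) mulr0.
Qed.

Definition weight_of_root b : weightv n := [ffun j => rpair C b j].

Lemma wref_root i b : wref C i (weight_of_root b) = weight_of_root (sref C i b).
Proof. by apply/ffunP => j; rewrite wrefE !ffunE rpair_sref. Qed.

Lemma wact_root s b : wact C s (weight_of_root b) = weight_of_root (ract C s b).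
Proof. by elim: s => //= i s ->; rewrite wref_root. Qed.

(** The bilinear form with Gram matrix [C]. Its invariance, evenness and definiteness are all that
    is used to control signs of roots. *)
Definition root_form b c : int := \sum_i rpair C b i * c i.

Lemma root_formDl b b' c : root_form (b + b') c = root_form b c + root_form b' c.
Proof. by rewrite -big_split; apply: eq_bigr => i _; rewrite rpairD mulrDl. Qed.

Lemma root_formDr b c c' : root_form b (c + c') = root_form b c + root_form b c'.
Proof. by rewrite -big_split; apply: eq_bigr => i _; rewrite ffunE mulrDr. Qed.

Lemma root_formNl b c : root_form (- b) c = - root_form b c.
Proof. by rewrite -sumrN; apply: eq_bigr => i _; rewrite rpairN mulNr. Qed.

Lemma root_formNr b c : root_form b (- c) = - root_form b c.
Proof. by rewrite -sumrN; apply: eq_bigr => i _; rewrite ffunE mulrN. Qed.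

Hypothesis HC : simply_laced_simple_cartan C.

Lemma cartan_diag i : C i i = 2.
Proof. by case: HC. Qed.

Lemma cartan_sym i j : C i j = C j i.
Proof. by case: HC. Qed.

Lemma cartan_off i j : i != j -> C i j = 0 \/ C i j = -1.
Proof. by case: HC => _ H _ _ _; apply: H. Qed.

Lemma cartan_adj_neq i j : C i j = -1 -> i != j.
Proof. by move=> Cij; apply: contra_eq_neq Cij => ->; rewrite cartan_diag. Qed.

Lemma srefK i : involutive (sref C i).
Proof.
move=> b; apply/ffunP => j; rewrite !srefE rpair_sref cartan_diag; ring.
Qed.

Lemma wrefK i : involutive (wref C i).
Proof.
move=> l; apply/ffunP => j; rewrite !wrefE cartan_diag; ring.
Qed.

Lemma ractK s : cancel (ract C s) (ract C (rev s)).
Proof.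
elim: s => [b|i s IHs b] //=; rewrite rev_cons -cats1 ract_cat /= srefK.
exact: IHs.
Qed.

Lemma ractKV s : cancel (ract C (rev s)) (ract C s).
Proof. by rewrite -{2}[s]revK; apply: ractK. Qed.

Lemma wactK s : cancel (wact C s) (wact C (rev s)).
Proof.
elim: s => [b|i s IHs b] //=; rewrite rev_cons -cats1 wact_cat /= wrefK.
exact: IHs.
Qed.

Lemma wactKV s : cancel (wact C (rev s)) (wact C s).
Proof. by rewrite -{2}[s]revK; apply: wactK. Qed.

Lemma wpair_wref i l b : wpair (wref C i l) b = wpair l (sref C i b).
Proof.
rewrite /wpair (eq_bigr (fun k => l k * b k - l i * (b k * C k i))); last first.
  by move=> k _; rewrite wrefE cartan_sym; ring.
rewrite [RHS](eq_bigr (fun k => l k * b k - l k * (k == i)%:Z * rpair C b i)).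
  rewrite !big_split /= !sumrN; congr (_ - _).
  rewrite -mulr_sumr -mulr_suml; congr (_ * _).
  rewrite (bigD1 i) //= eqxx mulr1 big1 ?addr0 // => k /negPf ->.
  by rewrite mulr0.
by move=> k _; rewrite srefE; ring.
Qed.

Lemma wpair_wact s l b : wpair (wact C s l) b = wpair l (ract C (rev s) b).
Proof.
elim: s b => //= i s IHs b.
by rewrite wpair_wref IHs rev_cons -cats1 ract_cat.
Qed.

Lemma wactE s l i : wact C s l i = wpair l (ract C (rev s) (simple_root i)).
Proof. by rewrite -wpair_wact wpair_simple. Qed.

Lemma root_formC b c : root_form b c = root_form c b.
Proof.
rewrite /root_form /rpair.
under eq_bigr do rewrite mulr_suml.
under [RHS]eq_bigr do rewrite mulr_suml.
rewrite exchange_big; apply: eq_bigr => i _; apply: eq_bigr => j _.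
by rewrite cartan_sym; ring.
Qed.

Lemma root_form_sref i b : root_form (sref C i b) (sref C i b) = root_form b b.
Proof.
have -> : root_form (sref C i b) (sref C i b) =
    \sum_j (rpair C b j - rpair C b i * C i j) * (b j - (j == i)%:Z * rpair C b i).
  by apply: eq_bigr => j _; rewrite rpair_sref srefE.
have -> : \sum_j (rpair C b j - rpair C b i * C i j) * (b j - (j == i)%:Z * rpair C b i)
  = \sum_j rpair C b j * b j - rpair C b i * \sum_j b j * C j i
    - \sum_j (j == i)%:Z * (rpair C b i * (rpair C b j - rpair C b i * C i j)).
  rewrite mulr_sumr -!sumrB; apply: eq_bigr => j _; rewrite (cartan_sym i j); ring.
rewrite [X in _ - X](bigD1 i) //= eqxx mul1r cartan_diag.
rewrite [\sum_(j | j != i) _]big1 => [|j /negPf->]; last by rewrite mul0r.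
rewrite -[\sum_j b j * C j i]/(rpair C b i) -[\sum_j rpair C b j * b j]/(root_form b b); ring.
Qed.

Lemma root_form_ract s b : root_form (ract C s b) (ract C s b) = root_form b b.
Proof. by elim: s => //= i s <-; rewrite root_form_sref. Qed.

Lemma root_form_simple i : root_form (simple_root i) (simple_root i) = 2.
Proof.
rewrite /root_form (bigD1 i) //= rpair_simple simple_rootE eqxx cartan_diag big1 //.
by move=> k /negPf ki; rewrite simple_rootE ki mulr0.
Qed.

Lemma root_form_gt0 b : b != 0 -> 0 < root_form b b.
Proof.
move=> b0; case: HC => _ _ _ /(_ (\row_j (b j)%:~R)) H _.
suff: 0 < (root_form b b)%:~R :> rat by rewrite ltr0z.
have -> : (root_form b b)%:~R = ((\row_j (b j)%:~R) *m map_mx (fun z : int => z%:~R) C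
    *m (\row_j (b j)%:~R)^T) 0 0 :> rat.
  rewrite !mxE rmorph_sum; apply: eq_bigr => i _; rewrite !mxE rmorphM rmorph_sum.
  by congr (_ * _); apply: eq_bigr => k _; rewrite !mxE rmorphM.
apply: H; apply: contraNneq b0 => /rowP H; apply/eqP/ffunP => j.
by have := H j; rewrite !mxE ffunE => /eqP; rewrite intr_eq0 => /eqP.
Qed.

(** Diagonal terms are [2 b_i^2], and off-diagonal terms come in equal pairs by symmetry of [C]. *)
Lemma root_form_even b : exists z : int, root_form b b = 2 * z.
Proof.
pose F i j := b j * C j i * b i.
have FC i j : F i j = F j i by rewrite /F (cartan_sym j i); ring.
exists (\sum_i b i * b i + \sum_(i < n.+1) \sum_(j < n.+1 | (j < i)%N) F i j).
have -> : root_form b b = \sum_i \sum_j F i j.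
  by apply: eq_bigr => i _; rewrite /rpair mulr_suml.
have -> : \sum_i \sum_j F i j = \sum_(i < n.+1) (2 * (b i * b i) +
    \sum_(j < n.+1 | (j < i)%N) F i j + \sum_(j < n.+1 | (i < j)%N) F i j).
  apply: eq_bigr => i _; rewrite (bigD1 i) //= /F cartan_diag -addrA; congr (_ + _).
    by ring.
  rewrite (bigID (fun j => (j < i)%N)) /=; congr (_ + _); apply: eq_bigl => j.
    by case: (ltngtP j i) (val_eqE j i) => /= [_ <-|_ <-|_ <-].
  by case: (ltngtP j i) (val_eqE j i) => /= [_ <-|_ <-|_ <-].
rewrite !big_split /= mulrDr -mulr_sumr -addrA; congr (_ + _).
rewrite [X in _ + X](exchange_big_dep predT) //=.
under [X in _ + X]eq_bigr do under eq_bigr do rewrite FC.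
ring.
Qed.

Definition nonneg b := forall j, 0 <= b j.

(* Writing [b = b+ - b-], disjointness of supports gives [(b+, b-) <= 0], so if both
   parts are nonzero, [(b, b) >= (b+, b+) + (b-, b-) >= 4] by evenness. *)
Lemma root_sign b : root_form b b = 2 -> nonneg b \/ nonneg (- b).
Proof.
move=> qb.
pose bp : rootv n := [ffun j => if 0 <= b j then b j else 0].
pose bm : rootv n := [ffun j => if 0 <= b j then 0 else - b j].
have bE : b = bp - bm.
  by apply/ffunP => j; rewrite !ffunE; case: (0 <= b j); rewrite ?subr0 ?sub0r ?opprK.
have [bm0|bm0] := eqVneq bm 0.
  by left => j; rewrite bE bm0 subr0 ffunE; case: ifP.
have [bp0|bp0] := eqVneq bp 0.
  by right => j; rewrite bE bp0 sub0r opprK ffunE; case: ifP; lia.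
have cross : root_form bp bm <= 0.
  rewrite /root_form /rpair; apply: sumr_le0 => i _; rewrite mulr_suml.
  apply: sumr_le0 => k _; have [->|ki] := eqVneq k i.
    by rewrite !ffunE; case: ifP => _; rewrite ?mulr0 ?mul0r.
  have : 0 <= bp k * bm i.
    by apply: mulr_ge0; rewrite ffunE; case: ifP => //; lia.
  by case: (cartan_off ki) => ->; lia.
have [[z1 e1] [z2 e2]] := (root_form_even bp, root_form_even bm).
have := root_form_gt0 bp0; have := root_form_gt0 bm0.
move: qb; rewrite bE root_formDl !root_formDr !root_formNl !root_formNr (root_formC bm bp) e1 e2.
lia.
Qed.

Lemma ract_sign s i :
  nonneg (ract C s (simple_root i)) \/ nonneg (- ract C s (simple_root i)).
Proof. by apply: root_sign; rewrite root_form_ract root_form_simple. Qed.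

Lemma root_form_scale (z : int) b :
  root_form [ffun j => z * b j] [ffun j => z * b j] = z * z * root_form b b.
Proof.
rewrite /root_form mulr_sumr; apply: eq_bigr => i _.
have -> : rpair C [ffun j => z * b j] i = z * rpair C b i.
  by rewrite /rpair mulr_sumr; apply: eq_bigr => k _; rewrite ffunE mulrA.
by rewrite ffunE; ring.
Qed.

(** * Exchange property and signs of roots along reduced words *)

Lemma same_elt_cat s s' t t' :
  same_elt C s s' -> same_elt C t t' -> same_elt C (s ++ t) (s' ++ t').
Proof. by move=> Hs Ht l; rewrite !wact_cat Ht Hs. Qed.

Lemma same_elt_rev s t : same_elt C s t -> same_elt C (rev s) (rev t).
Proof. by move=> H l; rewrite -{1}(wactKV t l) -H wactK. Qed.

Lemma wact_sub s l l' (a : int) :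
  wact C s [ffun j => l j - a * l' j] = [ffun j => wact C s l j - a * wact C s l' j].
Proof.
elim: s => [|i s IHs] /=; first by apply/ffunP => j; rewrite !ffunE.
by rewrite IHs; apply/ffunP => j; rewrite !ffunE; ring.
Qed.

(* [u s_t u^-1] is the reflection in [u(alpha_t)]. *)
Lemma conj_reflection u i j :
  ract C (rev u) (simple_root i) = simple_root j -> same_elt C (rcons u j) (i :: u).
Proof.
move=> H l; rewrite -cats1 wact_cat /=.
have -> : wref C j l = [ffun k => l k - l j * weight_of_root (simple_root j) k].
  by apply/ffunP => k; rewrite wrefE !ffunE rpair_simple.
rewrite wact_sub wact_root; have <- : simple_root i = ract C u (simple_root j).
  by rewrite -H ractKV.
by apply/ffunP => k; rewrite wrefE !ffunE rpair_simple (wactE u l i) H wpair_simple.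
Qed.

(** Follow [s^-1 alpha_i] while letters are appended to [s]. If the letter [x] turns a positive [g]
    negative, then [g] is supported at [x] alone, so [g = alpha_x] by its norm. Then
    [s s_x = s_i s], and the letters [i] and [x] cancel. *)
Lemma exchange_or_nonneg s i :
  nonneg (ract C (rev s) (simple_root i)) \/
  exists2 t, same_elt C (i :: s) t & (size t < size s)%N.
Proof.
elim/last_ind: s => [|s x [IHs|[t st ltts]]].
- by left => j /=; rewrite simple_rootE; case: eqP.
- rewrite rev_rcons /=; set g := ract C (rev s) _ in IHs *.
  have [|sxN] := ract_sign (x :: rev s) i; first by left.
  right; exists s; last by rewrite size_rcons.
  have gj j : j != x -> g j = 0.
    move=> jx; have := sxN j; rewrite /= ffunE srefE (negPf jx) mul0r subr0.
    rewrite -/g; have := IHs j; lia.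
  have gE : g = simple_root x.
    have gx : g = [ffun j => g x * simple_root x j].
      apply/ffunP => j; rewrite ffunE simple_rootE; have [->|jx] := eqVneq j x.
        by rewrite mulr1.
      by rewrite (gj _ jx) mulr0.
    have : root_form g g = 2 by rewrite root_form_ract root_form_simple.
    rewrite gx root_form_scale root_form_simple => q2.
    have -> : g x = 1 by have := IHs x; move: q2; nia.
    by apply/ffunP => j; rewrite ffunE mul1r.
  move=> l; have := conj_reflection gE; rewrite /same_elt => E.
  by rewrite /= E /= wrefK.
- right; exists (rcons t x); last by rewrite !size_rcons.
  rewrite -!cats1 -cat_cons; exact: same_elt_cat.
Qed.

Lemma reduced_cat_l s t : reduced_word C (s ++ t) -> reduced_word C s.
Proof.
move=> H u su; have := H (u ++ t) (same_elt_cat su (fun=> erefl)).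
by rewrite !size_cat leq_add2r.
Qed.

Lemma reduced_cat_r s t : reduced_word C (s ++ t) -> reduced_word C t.
Proof.
move=> H u tu; have := H (s ++ u) (same_elt_cat (fun=> erefl) tu).
by rewrite !size_cat leq_add2l.
Qed.

Lemma reduced_rev s : reduced_word C s -> reduced_word C (rev s).
Proof.
move=> H t /same_elt_rev; rewrite revK => /H; by rewrite !size_rev.
Qed.

Lemma reduced_nonneg s i :
  reduced_word C (i :: s) -> nonneg (ract C (rev s) (simple_root i)).
Proof.
move=> H; case: (exchange_or_nonneg s i) => // -[t /H /= + +]; lia.
Qed.

Lemma reduced_rcons_nonneg s i :
  reduced_word C (rcons s i) -> nonneg (ract C s (simple_root i)).
Proof.
by move/reduced_rev; rewrite rev_rcons => /reduced_nonneg; rewrite revK.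
Qed.

Lemma wact_ge0 s l i :
  reduced_word C (i :: s) -> (forall j, 0 <= l j) -> 0 <= wact C s l i.
Proof.
move=> /reduced_nonneg H l0; rewrite wactE; apply: sumr_ge0 => k _.
by rewrite mulr_ge0 ?H.
Qed.

Lemma ract_neq0 s i : ract C s (simple_root i) != 0.
Proof.
apply/eqP => H; have := root_form_ract s (simple_root i).
rewrite H root_form_simple /root_form big1 // => j _; by rewrite ffunE mulr0.
Qed.

Lemma wact_braid i j l : C i j = -1 -> wact C [:: i; j; i] l = wact C [:: j; i; j] l.
Proof.
move=> Cij; have Cji : C j i = -1 by rewrite cartan_sym.
by apply/ffunP => k; rewrite /= !wrefE !cartan_diag Cij Cji; ring.
Qed.

Lemma ract_braid i j b : C i j = -1 -> ract C [:: i; j; i] b = ract C [:: j; i; j] b.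
Proof.
move=> Cij; have Cji : C j i = -1 by rewrite cartan_sym.
by apply/ffunP => k; rewrite /= !srefE !rpair_sref !cartan_diag Cij Cji; ring.
Qed.

End Weyl.

(** * Operators satisfying sl2 and Serre relations *)

Section AbstractOperators.
Variables (K : numFieldType) (W : lmodType K).
Implicit Types (x v : W).

Lemma iter0_linear (X : {linear W -> W}) m : iter m X 0 = 0.
Proof. by elim: m => //= m ->; rewrite linear0. Qed.

Lemma iterD_linear (X : {linear W -> W}) m : {morph iter m X : x y / x + y}.
Proof. by move=> x y; elim: m => //= m ->; rewrite linearD. Qed.

Lemma iterZ_linear (X : {linear W -> W}) m (a : K) v :
  iter m X (a *: v) = a *: iter m X v.
Proof. by elim: m => //= m ->; rewrite linearZ. Qed.

Lemma iter_eq0_leq (X : {linear W -> W}) m m' v :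
  (m <= m')%N -> iter m X v = 0 -> iter m' X v = 0.
Proof. by move=> /subnK <- Hm; rewrite iterD Hm iter0_linear. Qed.

Section SL2.
Variables (E F : {linear W -> W}) (wt : int -> W -> Prop).
Hypothesis wtE : forall m x, wt m x -> wt (m + 2) (E x).
Hypothesis wtF : forall m x, wt m x -> wt (m - 2) (F x).
Hypothesis EF : forall m x, wt m x -> E (F x) = F (E x) + m%:~R *: x.

Lemma wt_iterF m x k : wt m x -> wt (m - (2 * k)%:Z) (iter k F x).
Proof.
move=> wx; elim: k => [|k IHk] /=; first by rewrite muln0 subr0.
have -> : m - (2 * k.+1)%:Z = m - (2 * k)%:Z - 2 by lia.
exact: wtF.
Qed.

Lemma sl2_E_iterF m x k : wt m x ->
  E (iter k.+1 F x) = iter k.+1 F (E x) + (k.+1%:~R * (m - k%:Z)%:~R) *: iter k F x.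
Proof.
move=> wx; elim: k => [|k IHk]; first by rewrite /= (EF wx) mul1r subr0.
rewrite iterS (EF (wt_iterF k.+1 wx)) IHk linearD linearZ /= -addrA -scalerDl.
congr (_ + _ *: _); rewrite -!intrM -intrD; congr (_%:~R); lia.
Qed.

Lemma sl2_hw_inj (m k : nat) x :
  wt m x -> E x = 0 -> (k <= m)%N -> iter k F x = 0 -> x = 0.
Proof.
move=> wx Ex; elim: k => // k IHk km Fx; apply: IHk; first exact: ltnW.
have := sl2_E_iterF k wx; rewrite Fx linear0 Ex iter0_linear add0r => /esym/eqP.
rewrite scaler_eq0 mulf_eq0 !intr_eq0 => /orP[/orP[]|/eqP //]; lia.
Qed.

(** Induction on the nilpotency order of [E]: [E x] satisfies the same hypotheses at weight [m + 2],
    hence is zero, and on a highest weight vector the scalars [k (m - k + 1)] with [k <= m] do not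
    vanish. The predicate [wt] is abstract so that the roles of [E] and [F] can be exchanged. *)
Lemma sl2_inj N (m : nat) x : wt m x -> iter N E x = 0 -> iter m F x = 0 -> x = 0.
Proof.
elim: N m x => [//|N IHN] m x wx Ex Fx.
apply: (sl2_hw_inj wx _ (leqnn m) Fx); apply: (IHN m.+2).
- have -> : m.+2%:Z = m%:Z + 2 by lia.
  exact: wtE.
- by rewrite -iterSr.
- have := sl2_E_iterF m.+1 wx; have Fx1 := iter_eq0_leq (leqnSn m) Fx.
  by rewrite Fx1 (iter_eq0_leq (leqnSn _) Fx1) linear0 scaler0 addr0 => <-.
Qed.

(** For [M > m] the scalar [(M + 1) (m - M)] is nonzero, so [F^(M+1) x = 0] gives [F^M x = 0];
    descend until [m + 1]. *)
Lemma sl2_hw_nilpotent M (m : nat) x :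
  wt m x -> E x = 0 -> iter M F x = 0 -> iter m.+1 F x = 0.
Proof.
move=> wx Ex; elim: M => [|M IHM] Fx; first exact: iter_eq0_leq Fx.
have [Mm|mM] := leqP M m; first exact: iter_eq0_leq Fx.
apply: IHM; have := sl2_E_iterF M wx.
rewrite Fx linear0 Ex iter0_linear add0r => /esym/eqP.
rewrite scaler_eq0 mulf_eq0 !intr_eq0 => /orP[/orP[]|/eqP //]; lia.
Qed.

Lemma sl2_nilpotent_E m M x : wt m x -> iter M F x = 0 -> iter M.+1 F (E x) = 0.
Proof.
move=> wx Fx; have := sl2_E_iterF M wx.
by rewrite iterS Fx !linear0 addr0 => <-.
Qed.

End SL2.

Section Serre.
Variables X Y : {linear W -> W}.
Hypothesis serreXY : forall v, X (X (Y v)) = 2 *: X (Y (X v)) - Y (X (X v)).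

(** The Serre relation says that [X] commutes with [[X, Y]], whence [X^(k+1) Y = Y X^(k+1) + (k + 1)
    [X, Y] X^k]. *)
Lemma serre_iter k v :
  iter k.+1 X (Y v) = k.+1%:R *: X (Y (iter k X v)) - k%:R *: Y (iter k.+1 X v).
Proof.
elim: k => [|k IHk]; first by rewrite /= scale1r scale0r subr0.
rewrite iterS IHk linearB !linearZ /= serreXY scalerBr scalerA.
rewrite addrAC !scalerN -scalerBl; congr (_ *: _ - _).
rewrite -!natrM -natrB; last lia.
by congr (_%:R); lia.
Qed.

Lemma serre_nilpotent M v : iter M X v = 0 -> iter M.+1 X (Y v) = 0.
Proof. by move=> H; rewrite serre_iter iterS H !linear0 ?scaler0 ?oppr0 ?addr0. Qed.

Hypothesis serreYX : forall v, Y (Y (X v)) = 2 *: Y (X (Y v)) - X (Y (Y v)).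

Let z v := X (Y v) - Y (X v).
Let u v := Y (X v).

Let Xz v : X (z v) = z (X v).
Proof.
by rewrite /z linearB /= serreXY scaler_nat mulr2n addrAC addrK.
Qed.

Let Yz v : Y (z v) = z (Y v).
Proof.
rewrite /z linearB /= serreYX scaler_nat mulr2n opprB addrCA; congr (_ + _).
by rewrite opprD addrA subrr add0r.
Qed.

Let Xu v : X (u v) = u (X v) + z (X v).
Proof. by rewrite /u /z addrC subrK. Qed.

Let uY v : u (Y v) = Y (u v) + Y (z v).
Proof. by rewrite -linearD /u /z /= addrC subrK. Qed.

Let A a v := iter a X (iter a Y v).

Let A_z a v : z (A a v) = A a (z v).
Proof.
rewrite /A; elim: a v => [//|a IHa] v.
by rewrite [iter a.+1 X _]iterS -Xz [iter a.+1 Y v]iterSr IHa -Yz -iterSr.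
Qed.

Let A_u a v : u (A a v) = A a (u v).
Proof.
elim: a v => [//|a IHa] v.
have AS w : A a.+1 w = X (A a (Y w)) by rewrite /A [iter a.+1 Y w]iterSr.
have uX w : u (X w) = X (u w - z w) by rewrite linearB /= Xu Xz addrK.
have AD : {morph A a : x y / x + y} by move=> x y; rewrite /A !iterD_linear.
by rewrite !AS uX IHa uY A_z -Yz AD addrK.
Qed.

Let u_iterX b v : u (iter b X v) = iter b X (u v - b%:R *: z v).
Proof.
elim: b v => [|b IHb] v; first by rewrite scale0r subr0.
rewrite iterSr IHb [RHS]iterSr; congr (iter b X _).
have -> x y : X (x - b.+1%:R *: y) = X x - b.+1%:R *: X y by rewrite linearB linearZ.
rewrite Xu Xz -natr1 scalerDl scale1r opprD.
by rewrite -addrA; congr (_ + _); rewrite addrCA subrr addr0.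
Qed.

Let A_comm a b v : A a (iter b Y (iter b X v)) = iter b Y (iter b X (A a v)).
Proof.
elim: b v => [//|b IHb] v.
(* Iterated, this reads [Y^b X^b = u (u - z) ... (u - (b - 1) z)]. *)
have BS w : iter b.+1 Y (iter b.+1 X w) = iter b Y (iter b X (u w - b%:R *: z w)).
  by rewrite -u_iterX [iter b.+1 Y _]iterSr.
have AB c x y : A a (x - c *: y) = A a x - c *: A a y.
  by rewrite /A -!scaleNr !iterD_linear !iterZ_linear.
by rewrite !BS IHb AB !(A_u, A_z).
Qed.

(* With [u = Y X], both [X^a Y^a] and [Y^b X^b] commute with [u] and with the central
   [z = [X, Y]], and the second is a polynomial in [u] and [z]. *)
Lemma verma_identity a b v :
  iter a X (iter (a + b) Y (iter b X v)) = iter b Y (iter (a + b) X (iter a Y v)).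
Proof.
rewrite [iter (a + b) Y _]iterD [(a + b)%N]addnC [iter (b + a) X _]iterD.
exact: A_comm.
Qed.

End Serre.
End AbstractOperators.

(** * Extremal vectors as functions on words *)

Section WordFunctions.
Variables (n : nat) (C : 'M[int]_n.+1) (K : numFieldType) (l : weightv n).
Hypothesis HC : simply_laced_simple_cartan C.
Notation V := (seq 'I_n.+1 -> K^o).
Implicit Types (i j k p q : 'I_n.+1) (J s t : seq 'I_n.+1) (phi psi : V) (nu b : rootv n).

Lemma wfD phi psi J : (phi + psi) J = (phi J : K) + (psi J : K) :> K.
Proof. by []. Qed.
Lemma wfN phi J : (- phi) J = - (phi J : K) :> K.
Proof. by []. Qed.
Lemma wfZ (a : K) phi J : (a *: phi) J = a * (phi J : K) :> K.
Proof. by []. Qed.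
Definition wfE := (wfD, wfN, wfZ).

Definition eop i phi : V := fun J => phi (i :: J).

Fact eop_is_linear i : linear (eop i).
Proof. by move=> a x y; apply/funext. Qed.
HB.instance Definition _ i := GRing.isLinear.Build K V V _ (eop i) (eop_is_linear i).

(** Words of content [nu] carry the weight [l - nu]; the empty word carries [l]. *)
Definition hcoef i J : int := l i - \sum_(s <- J) C s i.

Definition hop i phi : V := fun J => (hcoef i J)%:~R * phi J.

Fact hop_is_linear i : linear (hop i).
Proof.
move=> a x y; apply/funext => J; rewrite /hop !wfE mulrDr; congr (_ + _).
by rewrite mulrCA.
Qed.
HB.instance Definition _ i := GRing.isLinear.Build K V V _ (hop i) (hop_is_linear i).

(* The recursion is [e_k f_i = f_i e_k + [k = i] h_i], read on the word [k :: J]. *)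
Fixpoint fop_fix i phi J : K :=
  if J is k :: J' then (k == i)%:R * hop i phi J' + fop_fix i (eop k phi) J' else 0.
Definition fop i phi : V := fun J => fop_fix i phi J.

Fact fop_is_linear i : linear (fop i).
Proof.
move=> a x y; apply/funext => J; rewrite /fop; elim: J x y => [|k J IHJ] x y /=.
  by rewrite !wfE mulr0 addr0.
rewrite [eop k _]linearP IHJ [hop i _]linearP /= !wfE /=; ring.
Qed.
HB.instance Definition _ i := GRing.isLinear.Build K V V _ (fop i) (fop_is_linear i).

Lemma eop_fop k i phi : eop k (fop i phi) = fop i (eop k phi) + (k == i)%:R *: hop i phi.
Proof. by apply/funext => J; rewrite !wfE addrC. Qed.

Lemma fop_nil i phi : fop i phi [::] = 0.
Proof. by []. Qed.

Lemma word_fun_eq0 phi : phi [::] = 0 -> (forall k, eop k phi = 0) -> phi = 0.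
Proof.
move=> p0 pk; apply/funext => -[|k J] //.
by rewrite -[phi _]/(eop k phi J) pk.
Qed.

Lemma hop_eop i j phi : hop i (eop j phi) = eop j (hop i phi) + (C j i)%:~R *: eop j phi.
Proof.
apply/funext => J; rewrite /hop /eop !wfE -mulrDl -intrD; congr (_%:~R * _).
by rewrite /hcoef big_cons opprD addrA addrAC subrK.
Qed.

Lemma hop_fop i j phi : hop i (fop j phi) = fop j (hop i phi) + (- C j i)%:~R *: fop j phi.
Proof.
have hh psi : hop i (hop j psi) = hop j (hop i psi).
  by apply/funext => J; rewrite /hop mulrCA.
apply/funext => J; elim: J phi => [|k J IHJ] phi.
  by rewrite /hop !wfE !fop_nil !mulr0 addr0.
have E (psi : V) : psi (k :: J) = eop k psi J by [].
rewrite !E linearD linearZ /= !eop_fop.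
have -> : eop k (hop i (fop j phi)) =
    hop i (eop k (fop j phi)) - (C k i)%:~R *: eop k (fop j phi).
  by rewrite hop_eop addrK.
rewrite eop_fop linearD linearZ /= hh.
have -> : eop k (hop i phi) = hop i (eop k phi) - (C k i)%:~R *: eop k phi.
  by rewrite hop_eop addrK.
rewrite !linearB !linearZ /=.
move: (IHJ (eop k phi)); rewrite !wfE => ->.
by case: eqP => [->|_] /=; ring.
Qed.

(** The commutators of both sides with [eop k] produce terms that cancel by weights, so the
    difference of the two sides commutes with every [eop k]. Since it vanishes at the empty word,
    induction on the word kills it. *)
Lemma fop_serre p q phi : C p q = -1 ->
  fop p (fop p (fop q phi)) = 2 *: fop p (fop q (fop p phi)) - fop q (fop p (fop p phi)).
Proof.
move=> Cpq; have Cqp : C q p = -1 by rewrite (cartan_sym HC).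
apply/funext => J; elim: J phi => [|k J IHJ] phi.
  by rewrite !wfE !fop_nil !mulr0 subr0.
have E (psi : V) : psi (k :: J) = eop k psi J by [].
rewrite !E linearB linearZ /=.
rewrite !(eop_fop, linearD, linearZ, hop_fop, linearB) /=.
rewrite Cpq Cqp !(cartan_diag HC).
move: (IHJ (eop k phi)); rewrite !wfE => ->.
by ring.
Qed.

Lemma fop_comm p q phi : C p q = 0 -> fop p (fop q phi) = fop q (fop p phi).
Proof.
move=> Cpq; have Cqp : C q p = 0 by rewrite (cartan_sym HC).
apply/funext => J; elim: J phi => [|k J IHJ] phi; first by rewrite !fop_nil.
have E (psi : V) : psi (k :: J) = eop k psi J by [].
rewrite !E !(eop_fop, linearD, linearZ, hop_fop, linearB) /= Cpq Cqp !oppr0 !scale0r !addr0.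
move: (IHJ (eop k phi)); rewrite !wfE => ->; ring.
Qed.

Definition hwt i (m : int) phi := hop i phi = m%:~R *: phi.

Lemma hwt_eop i m phi : hwt i m phi -> hwt i (m + 2) (eop i phi).
Proof.
by rewrite /hwt hop_eop (cartan_diag HC) => ->; rewrite linearZ /= -scalerDl -intrD.
Qed.

Lemma hwt_fop i m phi : hwt i m phi -> hwt i (m - 2) (fop i phi).
Proof.
rewrite /hwt hop_fop (cartan_diag HC) => ->.
by rewrite linearZ /= -scalerDl -intrD.
Qed.

Lemma hwt_ef i m phi : hwt i m phi -> eop i (fop i phi) = fop i (eop i phi) + m%:~R *: phi.
Proof. by rewrite eop_fop eqxx scale1r => ->. Qed.

(** * Contents, integrability and Weyl group invariance of weights *)

Definition content J : rootv n := \sum_(j <- J) simple_root j.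

(** The zero function has every content, so bounds on [nu] require [phi] to be nonzero. *)
Definition has_content nu phi := forall J, phi J != 0 -> content J = nu.

Lemma content_cons k J : content (k :: J) = simple_root k + content J.
Proof. exact: big_cons. Qed.

Lemma content_ge0 J j : 0 <= content J j.
Proof.
elim: J => [|k J IHJ]; first by rewrite /content big_nil ffunE.
by rewrite content_cons ffunE addr_ge0 // simple_rootE; case: eqP.
Qed.

Lemma hcoef_content i J : hcoef i J = l i - rpair C (content J) i.
Proof.
congr (_ - _); elim: J => [|k J IHJ].
  by rewrite big_nil /content big_nil /rpair big1 // => j _; rewrite ffunE mul0r.
by rewrite big_cons content_cons rpairD rpair_simple IHJ.
Qed.

Lemma has_content_hwt nu phi i : has_content nu phi -> hwt i (l i - rpair C nu i) phi.
Proof.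
move=> hphi; apply/funext => J; rewrite /hop !wfE.
have [->|/hphi <-] := eqVneq (phi J) 0; first by rewrite !mulr0.
by rewrite hcoef_content.
Qed.

Lemma has_content_eop nu phi i : has_content nu phi -> has_content (nu - simple_root i) (eop i phi).
Proof. by move=> hphi J /hphi; rewrite content_cons => <-; rewrite addrC addKr. Qed.

Lemma has_content_fop nu phi i : has_content nu phi -> has_content (nu + simple_root i) (fop i phi).
Proof.
move=> hphi J; elim: J nu phi hphi => [|k J IHJ] nu phi hphi; first by rewrite fop_nil eqxx.
have -> : fop i phi (k :: J) = (k == i)%:R * hop i phi J + fop i (eop k phi) J :> K by [].
have [->|f0 _] := eqVneq (fop i (eop k phi) J : K) 0.
  rewrite addr0; case: (eqVneq k i) => [->|_]; last by rewrite mul0r eqxx.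
  rewrite mul1r /hop mulf_eq0 negb_or => /andP[_ /hphi <-].
  by rewrite content_cons addrC.
have := IHJ _ _ (has_content_eop (i := k) hphi) f0; rewrite content_cons => ->.
by rewrite addrCA addrA subrK addrC.
Qed.

Lemma homogZ nu phi (a : K) : has_content nu phi -> has_content nu (a *: phi).
Proof.
by move=> hphi J; rewrite !wfE mulf_eq0 negb_or => /andP[_ /hphi].
Qed.

Lemma rootMn b m j : (b *+ m) j = b j * m%:Z.
Proof. by rewrite ffunMnE -mulr_natr natz. Qed.

Lemma has_content_iter_fop m nu phi i :
  has_content nu phi -> has_content (nu + simple_root i *+ m) (iter m (fop i) phi).
Proof.
move=> hphi; elim: m => [|m IHm]; first by rewrite mulr0n addr0.
by rewrite mulrSr addrA; apply: has_content_fop.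
Qed.

Lemma has_content_iter_eop m nu phi i :
  has_content nu phi -> has_content (nu - simple_root i *+ m) (iter m (eop i) phi).
Proof.
move=> hphi; elim: m => [|m IHm]; first by rewrite mulr0n subr0.
by rewrite mulrSr opprD addrA; apply: has_content_eop.
Qed.

Lemma has_content_ge0 nu phi : has_content nu phi -> phi <> 0 -> nonneg nu.
Proof.
move=> hphi /eqP; apply: contra_neqP => nu0; apply/funext => J.
by apply/eqP; apply: contra_notT nu0 => /hphi <- j; apply: content_ge0.
Qed.

Lemma eop_nilpotent nu phi i : has_content nu phi -> exists m, iter m (eop i) phi = 0.
Proof.
move=> hphi; exists (absz (nu i)).+1; apply: contrapT => /(has_content_ge0 (has_content_iter_eop hphi)).
move=> /(_ i); rewrite !ffunE rootMn simple_rootE eqxx mul1r.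
have abs_lt (z : int) : ~ 0 <= z - (absz z).+1%:Z by lia.
exact: abs_lt.
Qed.

(** Local nilpotency is imposed on the lowering operators; for the raising ones it follows from a
    content, which cannot become negative. *)
Definition integrable phi := forall i, exists m, iter m (fop i) phi = 0.

Lemma integrable_fop phi j : integrable phi -> integrable (fop j phi).
Proof.
move=> iphi i; have [m fm] := iphi i; have [<-|ij] := eqVneq i j.
  by exists m; rewrite -iterSr iterS fm linear0.
case: (cartan_off HC ij) => Cij; last first.
  by exists m.+1; apply: serre_nilpotent => // v; apply: fop_serre.
have comm (h : nat) v : iter h (fop i) (fop j v) = fop j (iter h (fop i) v).
  by elim: h => //= h ->; rewrite fop_comm.
by exists m; rewrite comm fm linear0.
Qed.

Lemma integrable_eop nu phi j : has_content nu phi -> integrable phi -> integrable (eop j phi).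
Proof.
move=> hphi iphi i; have [m fm] := iphi i; have [<-|ij] := eqVneq i j.
  exists m.+1; exact: (sl2_nilpotent_E (hwt_fop (i := i)) (@hwt_ef i) (has_content_hwt i hphi) fm).
have comm (h : nat) v : iter h (fop i) (eop j v) = eop j (iter h (fop i) v).
  by elim: h => //= h ->; rewrite eop_fop eq_sym (negPf ij) scale0r addr0.
by exists m; rewrite comm fm linear0.
Qed.

Definition weight_space nu := exists phi, [/\ phi <> 0, has_content nu phi & integrable phi].

(* The action of [s_i] on the weight [l - nu], in terms of [nu]. *)
Definition dot_refl i nu : rootv n := nu + simple_root i *~ (l i - rpair C nu i).

(** With [m] the pairing of [l - nu] with [alpha_i], the vector is moved to the reflected weight by
    [f_i^m] or, for negative [m], by [e_i^(-m)]. Injectivity of these powers is sl2 theory for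
    nilpotent [e_i] and [f_i]. *)
Lemma weight_space_refl i nu : weight_space nu -> weight_space (dot_refl i nu).
Proof.
move=> [phi [phi0 hphi iphi]]; have wphi := has_content_hwt i hphi.
rewrite /dot_refl; case E : (l i - rpair C nu i) wphi => [m|m] wphi.
  exists (iter m (fop i) phi); split.
  - have [N eN] := eop_nilpotent i hphi => fm; apply: phi0.
    exact: (sl2_inj (hwt_eop (i := i)) (hwt_fop (i := i)) (@hwt_ef i) wphi eN fm).
  - exact: has_content_iter_fop.
  - by elim: (m) => //= k; apply: integrable_fop.
exists (iter m.+1 (eop i) phi); split.
- have [N fN] := iphi i => em; apply: phi0.
  (* The sl2 triple with [eop] and [fop] exchanged and all weights negated. *)
  have wtE (h : int) x : hwt i (- h) x -> hwt i (- (h + 2)) (fop i x).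
    by move=> /hwt_fop w; rewrite opprD.
  have wtF (h : int) x : hwt i (- h) x -> hwt i (- (h - 2)) (eop i x).
    by move=> /hwt_eop w; rewrite opprB addrC.
  have EF (h : int) x : hwt i (- h) x -> fop i (eop i x) = eop i (fop i x) + h%:~R *: x.
    by move=> /hwt_ef w; rewrite w intrN scaleNr addrNK.
  have w' : hwt i (- m.+1%:Z) phi by move: wphi; rewrite NegzE.
  exact: (sl2_inj wtE wtF EF w' fN em).
- by rewrite NegzE mulrNz -pmulrn; apply: has_content_iter_eop.
- elim: m.+1 => //= k; apply: integrable_eop; exact: has_content_iter_eop hphi.
Qed.

Definition dot s nu := foldr dot_refl nu s.

Lemma weight_space_dot s nu : weight_space nu -> weight_space (dot s nu).
Proof. by move=> wnu; elim: s => //= i s; apply: weight_space_refl. Qed.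

Lemma dot_reflE i nu j : dot_refl i nu j = nu j + (j == i)%:Z * (l i - rpair C nu i).
Proof.
rewrite /dot_refl ffunE; congr (_ + _).
case: (l i - _) => m; first by rewrite -pmulrn rootMn simple_rootE.
by rewrite NegzE mulrNz -pmulrn ffunE rootMn simple_rootE mulrN.
Qed.

Lemma rpair_dot_refl i nu j :
  rpair C (dot_refl i nu) j = rpair C nu j + (l i - rpair C nu i) * C i j.
Proof.
rewrite /rpair (eq_bigr (fun k => nu k * C k j + (k == i)%:Z * ((l i - rpair C nu i) * C k j))).
  rewrite big_split /=; congr (_ + _); rewrite (bigD1 i) //= eqxx mul1r.
  by rewrite big1 ?addr0 // => k /negPf ->; rewrite !mul0r.
by move=> k _; rewrite dot_reflE mulrDl mulrA.
Qed.

Lemma dot_reflK i : involutive (dot_refl i).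
Proof.
by move=> nu; apply/ffunP => j; rewrite !dot_reflE rpair_dot_refl (cartan_diag HC); ring.
Qed.

Lemma dotK s : cancel (dot s) (dot (rev s)).
Proof.
elim: s => [b|i s IHs b] //=; rewrite rev_cons -cats1 /dot foldr_cat /= dot_reflK.
exact: IHs.
Qed.

Lemma dotB s nu b : dot s (nu - b) = dot s nu - ract C s b.
Proof.
elim: s => //= i s ->; apply/ffunP => j.
have EB (x y : rootv n) : (x - y) j = x j - y j by rewrite !ffunE.
by rewrite EB !dot_reflE EB srefE rpairD rpairN; ring.
Qed.

Lemma wact_dot s i : wact C s l i = l i - rpair C (dot s 0) i.
Proof.
elim: s i => [|k s IHs] i /=.
  by rewrite /rpair big1 ?subr0 // => j _; rewrite ffunE mul0r.
by rewrite wrefE rpair_dot_refl !IHs; ring.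
Qed.

(** * Extremal vectors and their braid invariance *)

Definition vacuum : V := fun J => (J == [::])%:R.

Lemma has_content_vacuum : has_content 0 vacuum.
Proof. by move=> [|k J]; rewrite /content ?big_nil // /vacuum /= eqxx. Qed.

Lemma eop_vacuum i : eop i vacuum = 0.
Proof. by apply/funext. Qed.

(** The vector [f_i^(l_i+1)] applied to the vacuum is killed by every [eop k]: for [k = i] the sl2
    scalar is zero, and for other [k] the operators commute. As it vanishes at the empty word, it is
    zero; in a Verma module it would be a nonzero singular vector. *)
Lemma integrable_vacuum : (forall i, 0 <= l i) -> integrable vacuum.
Proof.
move=> l0 i; exists (absz (l i)).+1; apply: word_fun_eq0 => // k.
have w0 : hwt i (absz (l i)) vacuum.
  have := has_content_hwt i has_content_vacuum.
  by rewrite /rpair big1 ?subr0 => [|j _]; rewrite ?ffunE ?mul0r // gez0_abs.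
have [->|ki] := eqVneq k i.
  rewrite (sl2_E_iterF (hwt_fop (i := i)) (@hwt_ef i) _ w0) -[X in iter _ _ X + _]/(eop i vacuum).
  rewrite eop_vacuum iter0_linear.
  by rewrite subrr mulr0 scale0r addr0.
have comm m v : eop k (iter m (fop i) v) = iter m (fop i) (eop k v).
  by elim: m => //= m IHm; rewrite eop_fop IHm (negPf ki) scale0r addr0.
by rewrite comm eop_vacuum iter0_linear.
Qed.

(** The divided powers are those of [fdata]. For reduced words and dominant [l] the pairings are
    nonnegative, so [absz] changes nothing. *)
Fixpoint Phi s : V :=
  if s is k :: s' then
    (absz (wact C s' l k))`!%:R^-1 *: iter (absz (wact C s' l k)) (fop k) (Phi s')
  else vacuum.

Lemma integrable_Phi s : (forall i, 0 <= l i) -> integrable (Phi s).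
Proof.
move=> l0; elim: s => [|k s IHs] /=; first exact: integrable_vacuum.
move=> i; have : integrable (iter (absz (wact C s l k)) (fop k) (Phi s)).
  by elim: (absz _) => //= m; apply: integrable_fop.
by move=> /(_ i) [m fm]; exists m; rewrite iterZ_linear fm scaler0.
Qed.

Lemma has_content_Phi s : (forall i, 0 <= l i) -> reduced_word C s -> has_content (dot s 0) (Phi s).
Proof.
move=> l0; elim: s => [|k s IHs] rs /=; first exact: has_content_vacuum.
apply: homogZ; have := wact_ge0 HC rs l0; rewrite /dot_refl -wact_dot => m0.
rewrite -[X in _ *~ X]gez0_abs // -pmulrn; apply: has_content_iter_fop.
by apply: IHs; apply: (reduced_cat_r (s := [:: k])).
Qed.

(* Otherwise [e_i Phi_s] would have weight [s l + alpha_i], and by Weyl group invariance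
   of the set of weights, [l + s^-1 alpha_i] would be a weight. *)
Lemma eop_extremal s i :
  (forall i, 0 <= l i) -> reduced_word C (i :: s) -> eop i (Phi s) = 0.
Proof.
move=> l0 ris; have rs : reduced_word C s := reduced_cat_r (s := [:: i]) ris.
apply: contrapT => ephi.
have : weight_space (dot s 0 - simple_root i).
  exists (eop i (Phi s)); split => //; first exact/has_content_eop/has_content_Phi.
  by apply: integrable_eop (has_content_Phi l0 rs) _; apply: integrable_Phi.
move=> /(weight_space_dot (rev s)); rewrite dotB dotK sub0r => -[phi [phi0 hphi _]].
have := has_content_ge0 hphi phi0; have := reduced_nonneg HC ris => g0 g0'.
have /eqP[] := ract_neq0 HC (rev s) i; apply/ffunP => j.
have anti (z : int) : 0 <= - z -> 0 <= z -> z = 0 by lia.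
by have := g0' j; have := g0 j; rewrite !ffunE => h1 h2; apply: anti.
Qed.

Lemma fop_extremal s i : (forall i, 0 <= l i) -> reduced_word C (i :: s) ->
  iter (absz (wact C s l i)).+1 (fop i) (Phi s) = 0.
Proof.
move=> l0 ris; have rs : reduced_word C s := reduced_cat_r (s := [:: i]) ris.
have [m fm] := integrable_Phi s l0 i.
apply: (sl2_hw_nilpotent (hwt_fop (i := i)) (@hwt_ef i) _ (eop_extremal l0 ris) fm).
have := has_content_hwt i (has_content_Phi l0 rs).
by rewrite -wact_dot -{1}[wact C s l i]gez0_abs // wact_ge0.
Qed.

(** If [x] and [y] are the pairings of [s l] with [alpha_p] and [alpha_q], the exponents, innermost
    first, are [x, x + y, y] on one side and [y, x + y, x] on the other: Verma's identity. The
    letters of [a] only see the common weight. *)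
Lemma Phi_braid a s p q : C p q = -1 -> (forall i, 0 <= l i) ->
  reduced_word C ([:: p; q; p] ++ s) -> reduced_word C ([:: q; p; q] ++ s) ->
  Phi (a ++ [:: p; q; p] ++ s) = Phi (a ++ [:: q; p; q] ++ s).
Proof.
move=> Cpq l0 rp rq; have Cqp : C q p = -1 by rewrite (cartan_sym HC).
elim: a => [|k a IHa]; last first.
  have wE : wact C (a ++ [:: p; q; p] ++ s) l = wact C (a ++ [:: q; p; q] ++ s) l.
    by rewrite ![wact C (a ++ _) _]wact_cat ![wact C (_ ++ s) _]wact_cat (wact_braid HC).
  by rewrite !cat_cons /= wE IHa.
have x0 := wact_ge0 HC (reduced_cat_r (s := [:: p; q]) rp) l0.
have y0 := wact_ge0 HC (reduced_cat_r (s := [:: q; p]) rq) l0.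
rewrite /= !wrefE !(cartan_diag HC) Cpq Cqp.
move: x0 y0; case: (wact C s l p) => // x _; case: (wact C s l q) => // y _.
have -> : y%:Z - x%:Z * -1 = (y + x)%N by lia.
have -> : x%:Z - y%:Z * -1 = (y + x)%N by lia.
have -> : x%:Z - x%:Z * 2 - (y + x)%N%:Z * -1 = y by lia.
have -> : y%:Z - y%:Z * 2 - (y + x)%N%:Z * -1 = x by lia.
rewrite !iterZ_linear !scalerA /=.
rewrite (verma_identity (fop_serre (p := p) (q := q) ^~ Cpq)); last by move=> v; apply: fop_serre.
by congr (_ *: _); ring.
Qed.

End WordFunctions.

(** * Shuffle product and the determinantal identity *)

Section Shuffle.
Variables (n : nat) (C : 'M[int]_n.+1) (K : numFieldType).
Hypothesis HC : simply_laced_simple_cartan C.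
Notation V := (seq 'I_n.+1 -> K^o).
Implicit Types (i j k p q : 'I_n.+1) (J s t u : seq 'I_n.+1) (phi psi : V) (l : weightv n).

(** The product dual to the coproduct in which the [e_k] are primitive, so that each [eop k] is a
    derivation. *)
Fixpoint shuffle_fix phi psi J : K :=
  if J is k :: J' then shuffle_fix (eop k phi) psi J' + shuffle_fix phi (eop k psi) J'
  else phi [::] * psi [::].
Definition shuffle phi psi : V := fun J => shuffle_fix phi psi J.

Lemma eop_shuffle k phi psi :
  eop k (shuffle phi psi) = shuffle (eop k phi) psi + shuffle phi (eop k psi).
Proof. by []. Qed.

Lemma shuffleC phi psi : shuffle phi psi = shuffle psi phi.
Proof.
apply/funext => J; rewrite /shuffle; elim: J phi psi => [|k J IHJ] phi psi /=.
  by rewrite mulrC.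
by rewrite addrC; congr (_ + _); apply: IHJ.
Qed.

Definition shuffler psi phi : V := shuffle phi psi.

Fact shuffler_is_linear psi : linear (shuffler psi).
Proof.
rewrite /shuffler => a x y; apply/funext => J; elim: J x y psi => [|k J IHJ] x y psi.
  by rewrite !wfE /shuffle /= !wfE; ring.
have E (f : V) : f (k :: J) = eop k f J by [].
rewrite !wfE !E !eop_shuffle [eop k _]linearP /= !wfE !IHJ !wfE; ring.
Qed.
HB.instance Definition _ psi :=
  GRing.isLinear.Build K V V _ (shuffler psi) (shuffler_is_linear psi).

Lemma shuffleDl x y psi : shuffle (x + y) psi = shuffle x psi + shuffle y psi.
Proof. exact: (linearD (shuffler psi)). Qed.

Lemma shuffleZl (a : K) x psi : shuffle (a *: x) psi = a *: shuffle x psi.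
Proof. exact: (linearZZ (shuffler psi)). Qed.

Lemma shuffle0l psi : shuffle 0 psi = 0.
Proof. exact: (linear0 (shuffler psi)). Qed.

Lemma shuffleDr x y psi : shuffle psi (x + y) = shuffle psi x + shuffle psi y.
Proof. by rewrite shuffleC shuffleDl !(shuffleC _ psi). Qed.

Lemma shuffleZr (a : K) x psi : shuffle psi (a *: x) = a *: shuffle psi x.
Proof. by rewrite shuffleC shuffleZl (shuffleC _ psi). Qed.

Lemma shuffle0r psi : shuffle psi 0 = 0.
Proof. by rewrite shuffleC shuffle0l. Qed.

Lemma shuffle_vacuuml psi : shuffle (vacuum K) psi = psi.
Proof.
apply/funext => J; elim: J psi => [|k J IHJ] psi.
  by rewrite /shuffle /vacuum /= mul1r.
have E (f : V) : f (k :: J) = eop k f J by [].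
by rewrite !E eop_shuffle wfE eop_vacuum shuffle0l add0r IHJ.
Qed.

Lemma hop_shuffle l l' i phi psi :
  hop C (l + l') i (shuffle phi psi) =
  shuffle (hop C l i phi) psi + shuffle phi (hop C l' i psi).
Proof.
apply/funext => J; elim: J phi psi => [|k J IHJ] phi psi.
  by rewrite /hop /shuffle !wfE /= /hcoef !big_nil !subr0 ffunE intrD; ring.
have E (f : V) : f (k :: J) = eop k f J by [].
have X m (f : V) : eop k (hop C m i f) = hop C m i (eop k f) + (- C k i)%:~R *: eop k f.
  by rewrite hop_eop -addrA -scalerDl -intrD addrN scale0r addr0.
rewrite [RHS]wfE !E X !eop_shuffle !X linearD scalerDr /=.
rewrite !(shuffleDl, shuffleDr, shuffleZl, shuffleZr) !wfE.
have := IHJ (eop k phi) psi; have := IHJ phi (eop k psi).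
rewrite !wfE => -> ->; ring.
Qed.

(** Highest weights add: the shuffle product is a module morphism from the tensor product of the
    modules for [l] and [l'] to the module for [l + l']. *)
Lemma fop_shuffle l l' i phi psi :
  fop C (l + l') i (shuffle phi psi) =
  shuffle (fop C l i phi) psi + shuffle phi (fop C l' i psi).
Proof.
apply/funext => J; elim: J phi psi => [|k J IHJ] phi psi.
  by rewrite wfE /shuffle /= mul0r mulr0 addr0.
have E (f : V) : f (k :: J) = eop k f J by [].
rewrite [RHS]wfE !E eop_fop !eop_shuffle !eop_fop linearD hop_shuffle /=.
rewrite !(shuffleDl, shuffleDr, shuffleZl, shuffleZr) !wfE.
have := IHJ (eop k phi) psi; have := IHJ phi (eop k psi).
rewrite !wfE => -> ->; ring.
Qed.

(** In the Leibniz expansion of the power [a + b], every term but one applies more than [a]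
    operators on the left or more than [b] on the right. *)
Lemma iter_fop_shuffle l l' i a b phi psi :
  iter a.+1 (fop C l i) phi = 0 -> iter b.+1 (fop C l' i) psi = 0 ->
  iter (a + b) (fop C (l + l') i) (shuffle phi psi) =
  'C(a + b, a)%:R *: shuffle (iter a (fop C l i) phi) (iter b (fop C l' i) psi).
Proof.
move: {2}(a + b)%N (erefl (a + b)%N) => N.
elim: N a b phi psi => [|N IHN] a b phi psi abN fa fb.
  have [-> ->] : a = 0%N /\ b = 0%N by lia.
  by rewrite bin0 scale1r.
rewrite abN iterSr fop_shuffle iterD_linear.
case: a fa abN => [|a] fa abN.
  rewrite [fop C l i phi]fa shuffle0l iter0_linear add0r bin0 scale1r.
  case: b fb abN => [|b] fb abN; first lia.
  have -> : N = (0 + b)%N by lia.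
  by rewrite IHN -?iterSr ?bin0 ?scale1r //; lia.
case: b fb abN => [|b] fb abN.
  rewrite [fop C l' i psi]fb shuffle0r iter0_linear addr0.
  have -> : N = (a + 0)%N by lia.
  by rewrite IHN -?iterSr // ?addn0 ?binn //; lia.
have EN : N = (a + b.+1)%N by lia.
have EN' : N = (a.+1 + b)%N by lia.
rewrite {1}EN (IHN a b.+1) -?iterSr //.
rewrite EN' (IHN a.+1 b) -?iterSr //.
rewrite -scalerDl -natrD; congr (_%:R *: _).
by rewrite addSnnS binS addnC.
Qed.

(** The binomial coefficient turns the two divided powers into a single one. The operator that adds
    the letter [k] to a product of extremal vectors thus depends only on the sum of the two
    weights. *)
Lemma shuffle_Phi_cons l l' k u u' :
  (forall i, 0 <= l i) -> (forall i, 0 <= l' i) ->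
  reduced_word C (k :: u) -> reduced_word C (k :: u') ->
  shuffle (Phi C K l (k :: u)) (Phi C K l' (k :: u')) =
  (absz (wact C u l k + wact C u' l' k))`!%:R^-1 *:
  iter (absz (wact C u l k + wact C u' l' k)) (fop C (l + l') k)
    (shuffle (Phi C K l u) (Phi C K l' u')).
Proof.
move=> l0 l0' ru ru'; have a0 := wact_ge0 HC ru l0; have b0 := wact_ge0 HC ru' l0'.
have := fop_extremal K HC l0 ru; have := fop_extremal K HC l0' ru'.
rewrite /=; move: a0 b0; case: (wact C u l k) => // a _; case: (wact C u' l' k) => // b _.
rewrite !absz_nat => fb fa; rewrite iter_fop_shuffle //.
rewrite shuffleZl shuffleZr !scalerA; congr (_ *: _).
have := bin_fact (leq_addr b a); rewrite addKn => <-.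
rewrite !natrM; field.
by rewrite !pnatr_eq0 -!lt0n !fact_gt0 bin_gt0 leq_addr.
Qed.

Lemma wactD s l l' : wact C s (l + l') = wact C s l + wact C s l'.
Proof.
elim: s => //= i s ->; apply/ffunP => j.
by rewrite !(wrefE, ffunE); ring.
Qed.

Lemma fund_weight_ge0 i j : 0 <= fund_weight i j.
Proof. by rewrite ffunE; case: eqP. Qed.

Lemma fund_weightE i j : fund_weight i j = (j == i)%:Z.
Proof. by rewrite ffunE. Qed.

Lemma hop_vacuum l i : hop C l i (vacuum K) = (l i)%:~R *: vacuum K.
Proof.
apply/funext => -[|j J]; last by rewrite /hop wfE /vacuum /= !mulr0.
by rewrite /hop wfE /hcoef big_nil subr0.
Qed.

Lemma fop_vacuum l i k : eop k (fop C l i (vacuum K)) = ((k == i)%:R * (l i)%:~R) *: vacuum K.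
Proof. by rewrite eop_fop eop_vacuum linear0 add0r hop_vacuum scalerA. Qed.

Lemma fop_vacuum_eq0 l i : l i = 0 -> fop C l i (vacuum K) = 0.
Proof.
by move=> li; apply: word_fun_eq0 => // k; rewrite fop_vacuum li mulr0 scale0r.
Qed.

Section Determinantal.
Variables p q : 'I_n.+1.
Hypothesis Cpq : C p q = -1.
Notation wp := (fund_weight p).
Notation wq := (fund_weight q).

(** The three products of the determinantal identity have one total weight, so every further letter
    acts on all of them by the same divided power. *)
Lemma exchange_weights :
  wact C [:: p] wp + wact C [:: q] wq = wp + wact C [:: p; q] wq /\
  wact C [:: p] wp + wact C [:: q] wq = wact C [:: q; p] wp + wq.
Proof.
have Cqp : C q p = -1 by rewrite (cartan_sym HC).
have pq := cartan_adj_neq HC Cpq.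
split; apply/ffunP => j; rewrite /= !(wrefE, ffunE) !eqxx ?[q == p]eq_sym !(negPf pq) ?Cpq ?Cqp /=.
  by ring.
by ring.
Qed.

Lemma shuffle_exchange0 :
  shuffle (Phi C K wp [:: p]) (Phi C K wq [:: q]) =
  shuffle (Phi C K wp [::]) (Phi C K wq [:: p; q]) +
  shuffle (Phi C K wp [:: q; p]) (Phi C K wq [::]).
Proof.
have Cqp : C q p = -1 by rewrite (cartan_sym HC).
have pq := cartan_adj_neq HC Cpq.
rewrite /= !(wrefE, fund_weightE) !eqxx ?[q == p]eq_sym !(negPf pq) Cpq Cqp /=.
rewrite !invr1 !scale1r [shuffle (vacuum K) _]shuffle_vacuuml.
rewrite [shuffle _ (vacuum K)]shuffleC [shuffle (vacuum K) _]shuffle_vacuuml.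
apply/funext => -[|k J]; first by rewrite wfE /shuffle /= mulr0 addr0.
have E (f : V) : f (k :: J) = eop k f J by [].
have qp : (q == p) = false by rewrite eq_sym (negPf pq).
have eff (l : weightv n) i j : eop k (fop C l i (fop C l j (vacuum K))) =
    ((k == j)%:R * (l j)%:~R) *: fop C l i (vacuum K) +
    ((k == i)%:R * (l i - C j i)%:~R) *: fop C l j (vacuum K).
  rewrite eop_fop fop_vacuum hop_fop hop_vacuum !linearZ /=; congr (_ + _).
  by rewrite -scalerDl scalerA -intrD.
rewrite [RHS]wfE !E eop_shuffle !fop_vacuum !eff.
rewrite !fund_weightE !eqxx qp (negPf pq) Cpq Cqp.
rewrite (fop_vacuum_eq0 (l := wq) (i := p)) ?fund_weightE ?(negPf pq) //.
rewrite (fop_vacuum_eq0 (l := wp) (i := q)) ?fund_weightE ?qp //.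
rewrite !(shuffleDl, shuffleDr, shuffleZl, shuffleZr).
rewrite ![shuffle (vacuum K) _]shuffle_vacuuml ![shuffle _ (vacuum K)]shuffleC.
rewrite ![shuffle (vacuum K) _]shuffle_vacuuml !wfE.
have -> : false%:Z - -1 = 1 by [].
have -> : true%:Z = 1 by [].
have -> : (0 : V) J = 0 by [].
by ring.
Qed.

Let exchange_sum v k :
  wact C (v ++ [:: p]) wp k + wact C (v ++ [:: q]) wq k =
    wact C v wp k + wact C (v ++ [:: p; q]) wq k /\
  wact C (v ++ [:: p]) wp k + wact C (v ++ [:: q]) wq k =
    wact C (v ++ [:: q; p]) wp k + wact C v wq k.
Proof.
have D (x y : weightv n) : wact C v x k + wact C v y k = wact C v (x + y) k.
  by rewrite wactD ffunE.
rewrite !wact_cat !D; have [<- <-] := exchange_weights; by [].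
Qed.

Let reduced_prefix v s t : reduced_word C (v ++ s ++ t) -> reduced_word C (v ++ s).
Proof. by rewrite catA; apply: reduced_cat_l. Qed.

(** Letters of [v] are added on the left by one common linear operator. The two reducedness
    hypotheses together cover all the prefixes whose extremal vectors occur. *)
Lemma shuffle_exchange v :
  reduced_word C (v ++ [:: p; q; p]) -> reduced_word C (v ++ [:: q; p; q]) ->
  shuffle (Phi C K wp (v ++ [:: p])) (Phi C K wq (v ++ [:: q])) =
  shuffle (Phi C K wp v) (Phi C K wq (v ++ [:: p; q])) +
  shuffle (Phi C K wp (v ++ [:: q; p])) (Phi C K wq v).
Proof.
elim: v => [|k v IHv] rp rq; first exact: shuffle_exchange0.
have rv := reduced_cat_l rp.
have rvp := reduced_prefix (s := [:: p]) rp.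
have rvpq := reduced_prefix (s := [:: p; q]) rp.
have rvq := reduced_prefix (s := [:: q]) rq.
have rvqp := reduced_prefix (s := [:: q; p]) rq.
have [s1 s2] := exchange_sum v k.
have f0 := fund_weight_ge0.
rewrite !cat_cons !shuffle_Phi_cons // -s1 -s2 -scalerDr -iterD_linear; congr (_ *: iter _ _ _).
by apply: IHv; apply: (reduced_cat_r (s := [:: k])).
Qed.

Lemma size_fword_cons l k s :
  size (fword C (k :: s) l) = (absz (wact C s l k) + size (fword C s l))%N.
Proof. by rewrite /fword /= size_cat size_nseq. Qed.

(** [Dbar] is summed over words of one prescribed length, so additivity applies only once the three
    products are known to have equal degree. *)
Lemma size_exchange v :
  reduced_word C (v ++ [:: p; q; p]) -> reduced_word C (v ++ [:: q; p; q]) ->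
  (size (fword C (v ++ [:: p]) wp) + size (fword C (v ++ [:: q]) wq) =
     size (fword C v wp) + size (fword C (v ++ [:: p; q]) wq) /\
   size (fword C (v ++ [:: p]) wp) + size (fword C (v ++ [:: q]) wq) =
     size (fword C (v ++ [:: q; p]) wp) + size (fword C v wq))%N.
Proof.
have Cqp : C q p = -1 by rewrite (cartan_sym HC).
have pq := cartan_adj_neq HC Cpq.
elim: v => [|k v IHv] rp rq.
  rewrite /= !size_fword_cons /= !(wrefE, fund_weightE) !eqxx [q == p]eq_sym !(negPf pq).
  by rewrite Cpq Cqp.
have rv := reduced_cat_l rp.
have rvp := reduced_prefix (s := [:: p]) rp.
have rvpq := reduced_prefix (s := [:: p; q]) rp.
have rvq := reduced_prefix (s := [:: q]) rq.
have rvqp := reduced_prefix (s := [:: q; p]) rq.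
have [s1 s2] := exchange_sum v k.
have f0 := fund_weight_ge0.
have [] := IHv (reduced_cat_r (s := [:: k]) rp) (reduced_cat_r (s := [:: k]) rq).
rewrite !cat_cons !size_fword_cons.
have := wact_ge0 HC rv (f0 p); have := wact_ge0 HC rv (f0 q).
have := wact_ge0 HC rvp (f0 p); have := wact_ge0 HC rvq (f0 q).
have := wact_ge0 HC rvpq (f0 q); have := wact_ge0 HC rvqp (f0 p).
move: s1 s2; move: (wact C (v ++ [:: p]) wp k) (wact C (v ++ [:: q]) wq k) (wact C v wp k)
  (wact C (v ++ [:: p; q]) wq k) (wact C (v ++ [:: q; p]) wp k) (wact C v wq k) => a b c d e f.
lia.
Qed.

End Determinantal.

End Shuffle.

(** * Multiplicativity of Dbar *)

Section BigTuple.
Variables (R : nmodType) (T : finType).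

Lemma big_tuple_rcons d (F : seq T -> R) :
  \sum_(t : d.+1.-tuple T) F t = \sum_i \sum_(t : d.-tuple T) F (rcons t i).
Proof.
rewrite pair_big /= (reindex (fun x : T * d.-tuple T => [tuple of rcons x.2 x.1])) //=.
apply: onW_bij; apply: inj_card_bij.
  by move=> [i t] [j u] /= /(congr1 val) /= /rcons_inj[/val_inj -> ->].
by rewrite card_prod !card_tuple expnS.
Qed.

End BigTuple.

Section Dbar.
Variables (n : nat) (C : 'M[int]_n.+1).
Hypothesis HC : simply_laced_simple_cartan C.
Notation V := (seq 'I_n.+1 -> algC^o).
Implicit Types (i j k p q : 'I_n.+1) (J s t u : seq 'I_n.+1) (phi psi : V) (l : weightv n)
  (nu b c : rootv n).

Lemma rootpolyD b c : rootpoly (b + c) = rootpoly b + rootpoly c.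
Proof.
rewrite /rootpoly -big_split; apply: eq_bigr => k _ /=.
by rewrite ffunE intrD scalerDl.
Qed.

Lemma rootpoly_simple i : rootpoly (simple_root i) = 'X_i.
Proof.
rewrite /rootpoly (bigD1 i) //= simple_rootE eqxx scale1r big1 ?addr0 // => k ki.
by rewrite simple_rootE (negPf ki) scale0r.
Qed.

Lemma rootpoly_content J : rootpoly (content J) = \sum_(j <- J) 'X_j.
Proof.
elim: J => [|j J IHJ].
  rewrite big_nil /content big_nil /rootpoly big1 // => k _.
  by rewrite ffunE scale0r.
by rewrite content_cons rootpolyD rootpoly_simple IHJ big_cons.
Qed.

Lemma rootpoly_coeff b k : (rootpoly b)@_(U_(k))%MM = (b k)%:~R.
Proof.
rewrite /rootpoly raddf_sum (bigD1 k) //= mcoeffZ mcoeffX eqxx mulr1 big1 ?addr0 // => j jk.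
by rewrite mcoeffZ mcoeffX eq_mnm1 (negPf jk) mulr0.
Qed.

Lemma rootpoly_neq0 b : b != 0 -> rootpoly b != 0.
Proof.
apply: contra_neq => b0; apply/ffunP => k; apply/eqP.
by rewrite ffunE -(intr_eq0 algC) -rootpoly_coeff b0 mcoeff0.
Qed.

Lemma tofracA_eq0 x : (@tofracA n x == 0) = (x == 0).
Proof. exact: tofrac_eq0. Qed.

Lemma tofracAD x y : @tofracA n (x + y) = tofracA x + tofracA y.
Proof. exact: rmorphD. Qed.

Lemma tofracAM x y : @tofracA n (x * y) = tofracA x * tofracA y.
Proof. exact: rmorphM. Qed.

Lemma tofracA0 : @tofracA n 0 = 0.
Proof. exact: rmorph0. Qed.

Lemma tofracA1 : @tofracA n 1 = 1.
Proof. exact: rmorph1. Qed.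

Definition scalarA (a : algC) : fracA n := tofracA a%:MP.

Lemma scalarA0 : scalarA 0 = 0.
Proof. by rewrite /scalarA mpolyC0 tofracA0. Qed.

Lemma scalarAD (x y : algC) : scalarA (x + y) = scalarA x + scalarA y.
Proof. by rewrite /scalarA mpolyCD tofracAD. Qed.

Lemma scalarAM (x y : algC) : scalarA (x * y) = scalarA x * scalarA y.
Proof. by rewrite /scalarA mpolyCM tofracAM. Qed.

Definition Dbar d phi : fracA n :=
  \sum_(J : d.-tuple 'I_n.+1) scalarA (phi J) / tofracA (Dden J).

Lemma DbarD d phi psi : Dbar d (phi + psi) = Dbar d phi + Dbar d psi.
Proof.
by rewrite /Dbar -big_split; apply: eq_bigr => J _; rewrite wfE scalarAD mulrDl.
Qed.

Lemma DbarZ d a phi : Dbar d (a *: phi) = scalarA a * Dbar d phi.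
Proof.
by rewrite /Dbar mulr_sumr; apply: eq_bigr => J _; rewrite wfE scalarAM mulrA.
Qed.

Lemma Dbar0 d : Dbar d 0 = 0.
Proof. by rewrite /Dbar big1 // => J _; rewrite scalarA0 mul0r. Qed.

Definition rop i phi : V := fun J => phi (rcons J i).

Lemma rop_shuffle i phi psi :
  rop i (shuffle phi psi) = shuffle (rop i phi) psi + shuffle phi (rop i psi).
Proof.
apply/funext => J; rewrite wfE /rop; elim: J phi psi => [|k J IHJ] phi psi.
  by rewrite /shuffle.
have E (f : V) : f (k :: J) = eop k f J by [].
have E' (f : V) : f (rcons (k :: J) i) = eop k f (rcons J i) by [].
rewrite E' !E !eop_shuffle !wfE !IHJ /rop /eop /=.
by rewrite addrACA.
Qed.

Lemma content_rcons J i : content (rcons J i) = content J + simple_root i.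
Proof. by rewrite /content -cats1 big_cat big_seq1. Qed.

Lemma content_rop nu i phi : has_content nu phi -> has_content (nu - simple_root i) (rop i phi).
Proof. by move=> hphi J /hphi <-; rewrite content_rcons addrK. Qed.

Lemma Dden_rcons J i : Dden (rcons J i) = Dden J * rootpoly (content (rcons J i)).
Proof.
rewrite /Dden size_rcons big_ord_recr /=; congr (_ * _).
  apply: eq_bigr => t _; apply: eq_bigr => u _; rewrite nth_rcons.
  by rewrite (leq_trans (ltn_ord u) (ltn_ord t)).
by rewrite rootpoly_content [RHS](big_nth ord0) [RHS]big_mkord size_rcons.
Qed.

Lemma content_neq0 J : J != [::] -> content J != 0.
Proof.
case: J => // k J _; apply/eqP => /ffunP/(_ k).
rewrite content_cons !ffunE eqxx => H; have := content_ge0 J k; move: H.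
by case: (content J k).
Qed.

Lemma Dbar_rcons d nu phi : has_content nu phi ->
  Dbar d.+1 phi * tofracA (rootpoly nu) = \sum_i Dbar d (rop i phi).
Proof.
move=> hphi.
rewrite /Dbar (big_tuple_rcons _ (fun J => scalarA (phi J) / tofracA (Dden J))) mulr_suml.
apply: eq_bigr => i _; rewrite mulr_suml; apply: eq_bigr => J _.
have [E|] := eqVneq (phi (rcons J i)) 0; first by rewrite /rop E scalarA0 !mul0r.
move=> /hphi <-; rewrite Dden_rcons tofracAM invfM -!mulrA mulVf ?mulr1 //.
by rewrite tofracA_eq0 rootpoly_neq0 // content_neq0 //; case: (val J).
Qed.

Definition has_length d phi := forall J, phi J != 0 -> size J = d.

Lemma has_length0 phi : has_length 0 phi -> phi = (phi [::] : algC) *: vacuum algC.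
Proof.
move=> hphi; apply/funext => -[|k J]; rewrite wfE /vacuum /= ?mulr1 // mulr0.
by apply/eqP; apply: contraT => /hphi.
Qed.

Lemma length_rop d i phi : has_length d.+1 phi -> has_length d (rop i phi).
Proof. by move=> hphi J /hphi; rewrite size_rcons => -[]. Qed.

Lemma Dbar_length0 phi : Dbar 0 phi = scalarA (phi [::]).
Proof.
rewrite /Dbar (bigD1 [tuple]) //= big1 ?addr0 => [|J]; last by rewrite tuple0.
by rewrite /Dden big_ord0 tofracA1 divr1.
Qed.

Lemma content_shuffle nu1 nu2 phi psi :
  has_content nu1 phi -> has_content nu2 psi -> has_content (nu1 + nu2) (shuffle phi psi).
Proof.
move=> c1 c2 J; elim: J nu1 nu2 phi psi c1 c2 => [|k J IHJ] nu1 nu2 phi psi c1 c2.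
  rewrite /shuffle /= mulf_eq0 negb_or => /andP[/c1 <- /c2 <-].
  by rewrite /content big_nil addr0.
have -> : shuffle phi psi (k :: J) =
  shuffle (eop k phi) psi J + shuffle phi (eop k psi) J :> algC by [].
rewrite content_cons; have [E|s0 _] := eqVneq (shuffle (eop k phi) psi J : algC) 0.
  rewrite E add0r => /(IHJ _ _ _ _ c1 (has_content_eop (i := k) c2)) ->.
  by rewrite addrCA [simple_root k + _]addrC subrK.
by rewrite (IHJ _ _ _ _ (has_content_eop (i := k) c1) c2 s0) addrA [simple_root k + _]addrC subrK.
Qed.

(* The last factor of [Dden J] is the total sum, which is additive under shuffling,
   while removing the last letter is a derivation of the shuffle product. *)
Lemma Dbar_shuffle d1 d2 nu1 nu2 phi psi :
  has_length d1 phi -> has_length d2 psi -> has_content nu1 phi -> has_content nu2 psi ->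
  Dbar (d1 + d2) (shuffle phi psi) = Dbar d1 phi * Dbar d2 psi.
Proof.
move: {2}(d1 + d2)%N (erefl (d1 + d2)%N) => N.
elim: N d1 d2 nu1 nu2 phi psi => [|N IHN] d1 d2 nu1 nu2 phi psi dN l1 l2 c1 c2.
  have [? ?] : d1 = 0%N /\ d2 = 0%N by lia.
  by subst d1 d2; rewrite !Dbar_length0 -scalarAM.
case: d1 => [|d1] in dN l1 *.
  rewrite (has_length0 l1) shuffleZl shuffle_vacuuml DbarZ Dbar_length0 wfE /vacuum /=.
  by rewrite mulr1.
case: d2 => [|d2] in dN l2 *.
  rewrite (has_length0 l2) shuffleC shuffleZl shuffle_vacuuml DbarZ Dbar_length0 wfE /vacuum /=.
  by rewrite mulr1 mulrC addn0.
(* A zero factor leaves its content unconstrained, so [nu1 + nu2] could be zero and could not be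
   cancelled below. *)
have [->|/eqP phi0] := pselect (phi = 0); first by rewrite shuffle0l !Dbar0 mul0r.
have [->|/eqP psi0] := pselect (psi = 0); first by rewrite shuffle0r !Dbar0 mulr0.
have [J1 pJ1] : exists J, phi J != 0.
  apply: contrapT => nJ; move/eqP: phi0; apply; apply/funext => J.
  by apply/eqP; apply: contrapT => /negP pJ; apply: nJ; exists J.
have nu0 : tofracA (rootpoly (nu1 + nu2)) != 0.
  rewrite tofracA_eq0 rootpoly_neq0 // -(c1 _ pJ1); have := l1 _ pJ1.
  case: (J1) => // k J _; apply/eqP => /ffunP/(_ k).
  have g2 : 0 <= nu2 k by apply: (has_content_ge0 c2); apply/eqP.
  rewrite content_cons !ffunE eqxx => H; have := content_ge0 J k; move: H g2.
  by move: (nu2 k) (content J k) => x y; lia.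
apply: (mulIf nu0); rewrite addSn (Dbar_rcons _ (content_shuffle c1 c2)).
rewrite rootpolyD tofracAD mulrDr mulrAC (Dbar_rcons _ c1) -mulrA (Dbar_rcons _ c2).
rewrite mulr_suml mulr_sumr -big_split; apply: eq_bigr => i _ /=.
rewrite rop_shuffle DbarD; congr (_ + _).
  by apply: IHN (length_rop l1) l2 (content_rop c1) c2; lia.
by rewrite addnS -addSn; apply: IHN l1 (length_rop l2) c1 (content_rop c2); lia.
Qed.

(** * Minors as values of [Dbar] on extremal vectors *)

Lemma content_fops l K : has_content (content K) (foldr (fop C l) (vacuum algC) K).
Proof.
elim: K => [|k K IHK] /=; first by rewrite /content big_nil; apply: has_content_vacuum.
by rewrite content_cons addrC; apply: has_content_fop.
Qed.

Lemma size_content J : (size J)%:Z = \sum_k content J k.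
Proof.
elim: J => [|j J IHJ]; first by rewrite /content big_nil big1 // => k _; rewrite ffunE.
rewrite content_cons; under eq_bigr do rewrite ffunE.
rewrite big_split /= -IHJ (bigD1 j) //= simple_rootE eqxx big1 ?addr0 //.
by move=> k /negPf kj; rewrite simple_rootE kj.
Qed.

Lemma length_of_content J d phi : has_content (content J) phi -> size J = d -> has_length d phi.
Proof.
move=> c <- J' /c E; have := size_content J'; rewrite E -size_content; lia.
Qed.

(** [eact] reads its scalar off the word of lowering operators, [hop] off the argument. They agree
    because the function built from [K] is supported on words with the content of [K]. *)
Lemma eact_sum l i K :
  eop i (foldr (fop C l) (vacuum algC) K) =
  \sum_(x <- eact C l i K) x.1%:~R *: foldr (fop C l) (vacuum algC) x.2.
Proof.
elim: K => [|k K IHK] /=; first by rewrite big_nil eop_vacuum.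
rewrite eop_fop IHK big_cat big_map linear_sum /=; congr (_ + _).
  by apply: eq_bigr => x _; rewrite linearZ.
rewrite eq_sym; case: eqP => [->|_]; last by rewrite big_nil scale0r.
rewrite big_seq1 scale1r /=; apply/funext => J; rewrite wfE /hop.
have [->|f0] := eqVneq (foldr (fop C l) (vacuum algC) K J) 0; first by rewrite !mulr0.
congr (_%:~R * _).
by rewrite hcoef_content (content_fops f0) -hcoef_content.
Qed.

(** The map from the Verma module to the coinduced module sends a vector to its coefficients against
    the highest weight covector, and it intertwines the lowering operators. *)
Lemma mc_fops l J K : (mc C l J K)%:~R = foldr (fop C l) (vacuum algC) K J.
Proof.
elim: J K => [|i J IHJ] K /=; first by case: K.
have -> : foldr (fop C l) (vacuum algC) K (i :: J) =
  eop i (foldr (fop C l) (vacuum algC) K) J by [].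
rewrite eact_sum rmorph_sum /= fct_sumE; apply: eq_bigr => x _.
by rewrite intrM IHJ.
Qed.

Lemma Phi_fword l s :
  Phi C algC l s = (\prod_(x <- fdata C s l) x.1`!)%:R^-1 *:
    foldr (fop C l) (vacuum algC) (fword C s l).
Proof.
elim: s => [|k s IHs] /=; first by rewrite big_nil invr1 scale1r.
rewrite IHs iterZ_linear scalerA big_cons natrM invfM; congr (_ *: _).
rewrite /fword /= foldr_cat; elim: (absz _) => //= m ->; by [].
Qed.

Lemma Dbar_minorE l s : Dbar_minor C s l = Dbar (size (fword C s l)) (Phi C algC l s).
Proof.
apply: eq_bigr => J _; congr (tofracA _%:MP / _).
by rewrite /minor_coef mc_fops Phi_fword wfE mulrC.
Qed.

Lemma content_Phi_fword l s : has_content (content (fword C s l)) (Phi C algC l s).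
Proof. by rewrite Phi_fword; apply: homogZ; apply: content_fops. Qed.

Lemma Dbar_minorM l l' s t :
  Dbar_minor C s l * Dbar_minor C t l' =
  Dbar (size (fword C s l) + size (fword C t l')) (shuffle (Phi C algC l s) (Phi C algC l' t)).
Proof.
have c1 := @content_Phi_fword l s; have c2 := @content_Phi_fword l' t.
rewrite !Dbar_minorE; symmetry.
exact: Dbar_shuffle (length_of_content c1 erefl) (length_of_content c2 erefl) c1 c2.
Qed.

Lemma Dbar_exchange v p q : C p q = -1 ->
  reduced_word C (v ++ [:: p; q; p]) -> reduced_word C (v ++ [:: q; p; q]) ->
  Dbar_minor C (v ++ [:: p]) (fund_weight p) * Dbar_minor C (v ++ [:: q]) (fund_weight q) =
  Dbar_minor C v (fund_weight p) * Dbar_minor C (v ++ [:: p; q]) (fund_weight q) +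
  Dbar_minor C (v ++ [:: q; p]) (fund_weight p) * Dbar_minor C v (fund_weight q).
Proof.
move=> Cpq rp rq; rewrite !Dbar_minorM (shuffle_exchange _ HC Cpq rp rq) DbarD.
by have [<- <-] := size_exchange HC Cpq rp rq.
Qed.

(** The letter fixes the weight and contributes a divided power of exponent zero. *)
Lemma Dbar_minor_skip a x s l : wact C s l x = 0 ->
  Dbar_minor C (a ++ x :: s) l = Dbar_minor C (a ++ s) l.
Proof.
move=> x0; have wxs : wact C (x :: s) l = wact C s l.
  by apply/ffunP => j; rewrite /= wrefE x0 mul0r subr0.
have PhiE : Phi C algC l (a ++ x :: s) = Phi C algC l (a ++ s).
  elim: a => [|k a IHa]; last by rewrite !cat_cons /= IHa !wact_cat wxs.
  by rewrite /= x0 /= invr1 scale1r.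
have fwE : fword C (a ++ x :: s) l = fword C (a ++ s) l.
  elim: a {PhiE} => [|k a IHa]; first by rewrite /fword /= x0.
  rewrite /fword /= in IHa *; by rewrite IHa !wact_cat wxs.
by rewrite !Dbar_minorE PhiE fwE.
Qed.

Lemma size_fword_braid a s p q l : C p q = -1 -> (forall i, 0 <= l i) ->
  reduced_word C ([:: p; q; p] ++ s) -> reduced_word C ([:: q; p; q] ++ s) ->
  size (fword C (a ++ [:: p; q; p] ++ s) l) = size (fword C (a ++ [:: q; p; q] ++ s) l).
Proof.
move=> Cpq l0 rp rq; have Cqp : C q p = -1 by rewrite (cartan_sym HC).
elim: a => [|k a IHa]; last first.
  have wE : wact C (a ++ [:: p; q; p] ++ s) l = wact C (a ++ [:: q; p; q] ++ s) l.
    by rewrite ![wact C (a ++ _) _]wact_cat ![wact C (_ ++ s) _]wact_cat (wact_braid HC).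
  by rewrite !cat_cons !size_fword_cons wE IHa.
have x0 := wact_ge0 HC (reduced_cat_r (s := [:: p; q]) rp) l0.
have y0 := wact_ge0 HC (reduced_cat_r (s := [:: q; p]) rq) l0.
rewrite /= !size_fword_cons /= !wrefE !(cartan_diag HC) Cpq Cqp.
move: x0 y0; move: (wact C s l p) (wact C s l q) => x y; lia.
Qed.

Lemma Dbar_minor_braid a s p q l : C p q = -1 -> (forall i, 0 <= l i) ->
  reduced_word C ([:: p; q; p] ++ s) -> reduced_word C ([:: q; p; q] ++ s) ->
  Dbar_minor C (a ++ [:: p; q; p] ++ s) l = Dbar_minor C (a ++ [:: q; p; q] ++ s) l.
Proof.
move=> Cpq l0 rp rq.
by rewrite !Dbar_minorE (Phi_braid _ HC a Cpq l0 rp rq) (size_fword_braid a Cpq l0 rp rq).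
Qed.

Lemma Dbar_minor_nil l : Dbar_minor C [::] l = 1.
Proof. by rewrite Dbar_minorE Dbar_length0 /= /vacuum /= /scalarA mpolyC1 tofracA1. Qed.

End Dbar.

(** * Unique factorization and positions in a word *)

Section RootFactorization.
Variables (n : nat) (C : 'M[int]_n.+1).
Hypothesis HC : simply_laced_simple_cartan C.
Implicit Types (i j k : 'I_n.+1) (b c : rootv n) (s t : seq (rootv n)).

Lemma posroot_form b : is_posroot C b -> root_form C b b = 2.
Proof. by move=> [[s [i <-]] _]; rewrite root_form_ract // root_form_simple. Qed.

Lemma posroot_neq0 b : is_posroot C b -> b != 0.
Proof. by move=> [[s [i <-]] _]; apply: ract_neq0. Qed.

Lemma neq0_coord b : b != 0 -> exists k, b k != 0.
Proof.
move=> b0; apply: contrapT => nb; move/eqP: b0; apply; apply/ffunP => k.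
by rewrite ffunE; apply/eqP; apply: contrapT => /negP bk; apply: nb; exists k.
Qed.

(** Both norms are 2, so the ratio is [1] or [-1], and nonnegative coordinates exclude [-1]. *)
Lemma posroot_proportional b c k : is_posroot C b -> is_posroot C c -> b k != 0 ->
  (forall j, c j * b k = c k * b j) -> b = c.
Proof.
move=> rb rc bk cb; have qb := posroot_form rb; have qc := posroot_form rc.
have E : [ffun j => b k * c j] = [ffun j => c k * b j].
  by apply/ffunP => j; rewrite !ffunE mulrC cb.
have := root_form_scale C (b k) c; rewrite E root_form_scale qb qc => E2.
have b0 := rb.2 k; have c0 := rc.2 k.
have ck : c k = b k by move: (b k) (c k) bk b0 c0 E2 => x y; nia.
apply/ffunP => j; have := cb j; rewrite ck mulrC => /(mulfI bk) ->.
by [].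
Qed.

Lemma prodroots_cons b s : prodroots (b :: s) = rootpoly b * prodroots s.
Proof. exact: big_cons. Qed.

Lemma prodroots_cat s t : prodroots (s ++ t) = prodroots s * prodroots t.
Proof. exact: big_cat. Qed.

Definition posroots s := forall b, b \in s -> is_posroot C b.

Lemma prodroots_neq0 s : posroots s -> prodroots s != 0.
Proof.
move=> ps; rewrite /prodroots prodf_seq_neq0; apply/allP => b /ps /posroot_neq0.
exact: rootpoly_neq0.
Qed.

(* A substitution whose kernel on linear forms is the line spanned by [b]. *)
Definition kill_root b k : n.+1.-tuple (polyA n) :=
  [tuple if j == k then \sum_(i | i != k) (- ((b i)%:~R / (b k)%:~R)) *: 'X_i else 'X_j
   | j < n.+1].

Lemma kill_root_coeff b k c j : j != k ->
  (rootpoly c \mPo kill_root b k)@_(U_(j))%MM =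
  (c j)%:~R - (c k)%:~R * ((b j)%:~R / (b k)%:~R) :> algC.
Proof.
move=> jk; rewrite /rootpoly rmorph_sum raddf_sum /=.
have mX i : ('X_i : polyA n)@_(U_(j))%MM = (i == j)%:R by rewrite mcoeffX eq_mnm1.
rewrite (bigD1 k) //= comp_mpolyZ comp_mpolyXU mcoeffZ -tnth_nth tnth_mktuple eqxx.
rewrite raddf_sum (bigD1 j) //= mcoeffZ mX eqxx mulr1 big1 ?addr0; last first.
  by move=> i /andP[_ /negPf ij]; rewrite mcoeffZ mX ij mulr0.
rewrite (bigD1 j) //= comp_mpolyZ comp_mpolyXU mcoeffZ -tnth_nth tnth_mktuple (negPf jk) mX.
rewrite eqxx mulr1 big1 ?addr0 => [|i /andP[/negPf ik /negPf ij]].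
  by rewrite addrC mulrN.
by rewrite comp_mpolyZ comp_mpolyXU mcoeffZ -tnth_nth tnth_mktuple ik mX ij mulr0.
Qed.

Lemma kill_root_self b k : b k != 0 -> rootpoly b \mPo kill_root b k = 0.
Proof.
move=> bk; rewrite /rootpoly rmorph_sum /= (bigD1 k) //= comp_mpolyZ comp_mpolyXU.
rewrite -tnth_nth tnth_mktuple eqxx scaler_sumr -big_split big1 //= => i ik.
rewrite comp_mpolyZ comp_mpolyXU -tnth_nth tnth_mktuple (negPf ik) scalerA -scalerDl.
by rewrite mulrN mulrCA divff ?intr_eq0 // mulr1 addNr scale0r.
Qed.

(** Substituting along the hyperplane [b = 0] kills the left side, hence some factor [c] on the
    right; then [c] is proportional to [b], hence equal to it. *)
Lemma prodroots_mem b s t : is_posroot C b -> posroots t ->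
  prodroots (b :: s) = prodroots t -> b \in t.
Proof.
move=> rb pt E; have [k bk] := neq0_coord (posroot_neq0 rb).
have := congr1 (fun x => x \mPo kill_root b k) E.
rewrite prodroots_cons rmorphM /= kill_root_self // mul0r /prodroots rmorph_prod /=.
move=> /esym/eqP; rewrite prodf_seq_eq0 => /hasP[c ct /= /eqP c0].
rewrite (posroot_proportional rb (pt _ ct) bk) // => j.
have [->//|jk] := eqVneq j k.
have := kill_root_coeff b c jk; rewrite c0 mcoeff0 => /esym/eqP.
rewrite subr_eq0 mulrA => /eqP cj; apply: (@intr_inj algC).
by rewrite !intrM cj divfK // intr_eq0.
Qed.

Lemma prodroots_inj s t : posroots s -> posroots t ->
  prodroots s = prodroots t -> perm_eq s t.
Proof.
elim: s t => [|b s IHs] t ps pt E.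
  case: t pt E => // c t pt /esym/prodroots_mem H.
  have p0 : posroots [::] by [].
  by have := H (pt _ (mem_head _ _)) p0.
have rb : is_posroot C b by apply: ps; rewrite mem_head.
have bt := prodroots_mem rb pt E.
rewrite (permPr (perm_to_rem bt)) perm_cons; apply: IHs.
- by move=> c cs; apply: ps; rewrite in_cons cs orbT.
- by move=> c /mem_rem; apply: pt.
apply: (mulfI (rootpoly_neq0 (posroot_neq0 rb))).
rewrite -!prodroots_cons E; exact: perm_big (perm_to_rem bt).
Qed.

Lemma prodroots_perm s t : perm_eq s t -> prodroots s = prodroots t.
Proof. exact: perm_big. Qed.

Lemma prodroots_count s t :
  (forall b, count_mem b s = count_mem b t) -> prodroots s = prodroots t.
Proof. by move=> H; apply/prodroots_perm/allP => b _; apply/eqP/H. Qed.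

End RootFactorization.

Section Positions.
Variables (n : nat).
Implicit Types (w : seq 'I_n.+1) (j l i : nat) (r : 'I_n.+1).

(** [jminus] for an arbitrary letter. The value 0 stands for no occurrence and is matched by
    [P_0 = 1]. *)
Definition lastp w j r := \max_(1 <= l < j | letter w l == r) l.

Lemma lastp1 w r : lastp w 1 r = 0%N.
Proof. by rewrite /lastp big_geq. Qed.

Lemma lastpS w j r : (0 < j)%N ->
  lastp w j.+1 r = if letter w j == r then j else lastp w j r.
Proof.
move=> j0; rewrite /lastp big_mkcond big_nat_recr //= -big_mkcond /=.
case: ifP => _; last by rewrite maxn0.
apply/maxn_idPr; rewrite big_seq_cond; apply/bigmax_leqP_seq => l _.
by rewrite mem_index_iota => /andP[/andP[_ /ltnW]].
Qed.

Lemma lastp_lt w j r : (0 < j)%N -> (lastp w j r < j)%N.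
Proof.
case: j => // j _; elim: j => [|j IHj]; first by rewrite lastp1.
by rewrite lastpS //; case: ifP => // _; apply: ltnW.
Qed.

Lemma lastp_letter w j r : (0 < lastp w j r)%N -> letter w (lastp w j r) = r.
Proof.
case: j => [|j]; first by rewrite /lastp big_geq.
elim: j => [|j IHj]; first by rewrite lastp1.
by rewrite lastpS //; case: eqP.
Qed.

Lemma lastp_max w j r i : (0 < i < j)%N -> letter w i = r -> (i <= lastp w j r)%N.
Proof.
case: j => [|j]; first by rewrite ltn0 andbF.
elim: j => [|j IHj] ij; first lia.
move=> ir; rewrite lastpS //; case: eqP => [_|nj]; first by case/andP: ij.
have ne : i <> j.+1 by move=> E; apply: nj; rewrite -E.
by apply: IHj => //; lia.
Qed.

Lemma jplus_gt w l : (l < jplus w l)%N.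
Proof. by rewrite /jplus addn1 addSn ltnS leq_addr. Qed.

Lemma nth_drop_letter w l i : nth ord0 (drop l w) i = letter w (l + i).+1.
Proof. by rewrite nth_drop. Qed.

Lemma jplus_letter w l : (l <= size w)%N -> (jplus w l <= size w)%N ->
  letter w (jplus w l) = letter w l.
Proof.
move=> lw; rewrite /jplus => jw.
have H : has (pred1 (letter w l)) (drop l w) by rewrite has_find size_drop ltn_subRL -addSn -[l.+1]addn1.
by have /eqP := nth_find ord0 H; rewrite nth_drop_letter addn1 addSn.
Qed.

Lemma jplus_min w l i : (l < i < jplus w l)%N -> letter w i <> letter w l.
Proof.
move=> li; have H : (i - l.+1 < find (pred1 (letter w l)) (drop l w))%N.
  by move: li; rewrite /jplus; move: (find _ _) => f; lia.
have := before_find ord0 H; rewrite nth_drop_letter /= => /eqP.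
by have -> : (l + (i - l.+1)).+1 = i by lia.
Qed.

Lemma lastp_jplus w l : (0 < l <= size w)%N -> (jplus w l <= size w)%N ->
  lastp w (jplus w l) (letter w (jplus w l)) = l.
Proof.
move=> /andP[l0 lw] jw; rewrite jplus_letter //; apply/eqP; rewrite eqn_leq.
rewrite lastp_max ?l0 ?jplus_gt // andbT leqNgt; apply/negP => H.
apply: (@jplus_min w l (lastp w (jplus w l) (letter w l))).
  by rewrite H lastp_lt // (leq_ltn_trans _ (jplus_gt w l)).
by rewrite lastp_letter //; lia.
Qed.

(** The condition [l < j < l_+] selects, for each letter other than that of [j], its last occurrence
    before [j]. *)
Lemma jplus_lastp_gt w j l r : (0 < l < j)%N -> (j <= size w)%N -> letter w l = r ->
  letter w j <> r -> (j < jplus w l)%N = (l == lastp w j r).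
Proof.
move=> lj jw lr jr; apply/idP/eqP => [jl|E].
  apply/eqP; rewrite eqn_leq lastp_max //= leqNgt; apply/negP => H.
  have lt := @lastp_lt w j r; apply: (@jplus_min w l (lastp w j r)); first lia.
  by rewrite lastp_letter //; lia.
rewrite ltnNge; apply/negP => H.
have jlet : letter w (jplus w l) = r by rewrite jplus_letter //; lia.
have jne : jplus w l <> j by move=> E'; apply: jr; rewrite -E'.
have gt := jplus_gt w l; have le : (jplus w l <= lastp w j r)%N by apply: lastp_max => //; lia.
by move: le; rewrite -E; lia.
Qed.

Lemma jplus_of_lastp w j : (0 < j <= size w)%N -> (0 < lastp w j (letter w j))%N ->
  jplus w (lastp w j (letter w j)) = j.
Proof.
move=> /andP[j0 jw] l0; set l := lastp _ _ _ in l0 *.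
have lj : (l < j)%N := lastp_lt w _ j0.
have ll : letter w l = letter w j by apply: lastp_letter.
apply/eqP; rewrite eqn_leq; apply/andP; split; rewrite leqNgt; apply/negP => H.
  by apply: (@jplus_min w l j); rewrite ?lj.
have jl : letter w (jplus w l) = letter w j by rewrite jplus_letter //; lia.
have gt := jplus_gt w l; have le : (jplus w l <= l)%N by apply: lastp_max => //; lia.
lia.
Qed.

(** The product in (B) becomes a product over letters, where letters that have not yet occurred
    contribute [F 0 = 1]. Such a product is easy to compare across a braid move. *)
Lemma prod_lastp (R : comNzRingType) w j (Q : pred 'I_n.+1) (F : nat -> R) :
  (0 < j <= size w)%N -> F 0%N = 1 -> ~~ Q (letter w j) ->
  \prod_(1 <= l < j | (j < jplus w l)%N && Q (letter w l)) F l =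
  \prod_(r | Q r) F (lastp w j r).
Proof.
move=> /andP[j0 jw] F0 nQ.
rewrite (partition_big (letter w) Q) /=; last by move=> l /andP[].
apply: eq_bigr => r Qr; have rj : letter w j <> r by move=> E; rewrite E Qr in nQ.
rewrite big_seq_cond (eq_bigl (fun l => (l \in index_iota 1 j) && (l == lastp w j r))); last first.
  move=> l; rewrite mem_index_iota; apply/andP/andP => -[lj].
    by move=> /andP[/andP[jl _] /eqP lr]; split => //; rewrite -(jplus_lastp_gt _ jw lr rj).
  move=> /eqP E; have lr : letter w l = r by rewrite E lastp_letter // -E; lia.
  by split => //; rewrite (jplus_lastp_gt lj jw lr rj) lr Qr eqxx E eqxx.
rewrite -big_seq_cond; have [L0|Lpos] := posnP (lastp w j r).
  rewrite L0 F0 big_seq_cond big1 // => l; rewrite mem_index_iota; lia.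
rewrite -big_filter filter_pred1_uniq ?iota_uniq ?big_seq1 //.
by rewrite mem_index_iota Lpos lastp_lt.
Qed.

End Positions.

(** * Properties (A), (B), (C) as multiplicity conditions *)

Section Counts.
Variables (n : nat) (C : 'M[int]_n.+1).
Hypothesis HC : simply_laced_simple_cartan C.
Implicit Types (w : seq 'I_n.+1) (m : nat -> seq (rootv n)) (r : 'I_n.+1) (b : rootv n).

Definition factors m j := if j == 0%N then [::] else m j.

Lemma PjE m j : Pj m j = prodroots (factors m j).
Proof. by rewrite /Pj /factors; case: eqP => // _; rewrite /prodroots big_nil. Qed.

Definition last_factors w m j r := factors m (lastp w j r).

Lemma last_factorsS w m j r : (0 < j)%N ->
  last_factors w m j.+1 r = if letter w j == r then m j else last_factors w m j r.
Proof.
move=> j0; rewrite /last_factors lastpS //; case: ifP => // _.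
by rewrite /factors; case: j j0.
Qed.

Lemma propB_prod w m j : (1 <= j <= size w)%N ->
  \prod_(1 <= l < j | (j < jplus w l)%N && (C (letter w l) (letter w j) == -1)) Pj m l =
  \prod_(r | C r (letter w j) == -1) prodroots (last_factors w m j r).
Proof.
move=> jw; rewrite (prod_lastp (Q := fun r => C r (letter w j) == -1) (F := Pj m)) //.
  by apply: eq_bigr => r _; rewrite PjE.
by rewrite cartan_diag.
Qed.

Lemma prodroots_flatten (s : seq (seq (rootv n))) :
  prodroots (flatten s) = \prod_(t <- s) prodroots t.
Proof.
elim: s => [|t s IHs] /=; first by rewrite /prodroots !big_nil.
by rewrite prodroots_cat IHs big_cons.
Qed.

Lemma count_flatten_sum b (s : seq (seq (rootv n))) :
  (count_mem b (flatten s) = \sum_(t <- s) count_mem b t)%N.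
Proof.
elim: s => [|t s IHs] /=; first by rewrite big_nil.
by rewrite count_cat IHs big_cons.
Qed.

(** Multiplicities turn (B) into linear equations over the naturals, one for each root; unique
    factorization makes the passage reversible. *)
Definition propBc w m := forall j, (1 <= j <= size w)%N -> forall b,
  (count_mem b (m j) + count_mem b (last_factors w m j (letter w j)) =
   (beta C w j == b) + \sum_(r | C r (letter w j) == -1%R) count_mem b (last_factors w m j r))%N.

Let neighbours w m j :=
  flatten [seq last_factors w m j r | r <- enum 'I_n.+1 & C r (letter w j) == -1].

Lemma count_neighbours w m j b : count_mem b (neighbours w m j) =
  (\sum_(r | C r (letter w j) == -1%R) count_mem b (last_factors w m j r))%N.
Proof. by rewrite count_flatten_sum big_map big_filter big_enum_cond. Qed.

Lemma prodroots_neighbours w m j : prodroots (neighbours w m j) =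
  \prod_(r | C r (letter w j) == -1) prodroots (last_factors w m j r).
Proof. by rewrite prodroots_flatten big_map big_filter big_enum_cond. Qed.

Lemma propBc_propB w m : propBc w m -> propB C w m.
Proof.
move=> H j jw; rewrite propB_prod // -prodroots_neighbours -prodroots_cons.
rewrite !PjE -prodroots_cat; apply: prodroots_count => b.
have -> : factors m j = m j by rewrite /factors; case: j jw.
by rewrite count_cat /= count_neighbours -H.
Qed.

Definition all_posroots w m := forall j, (1 <= j <= size w)%N -> posroots C (m j).

Lemma posroots_last w m j r : all_posroots w m -> (1 <= j <= (size w).+1)%N ->
  posroots C (last_factors w m j r).
Proof.
move=> H jw; rewrite /last_factors /factors; case: eqP => // lj.
by apply: H; have := @lastp_lt _ w j r; lia.
Qed.

Lemma propB_propBc w m : all_posroots w m ->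
  (forall j, (1 <= j <= size w)%N -> is_posroot C (beta C w j)) ->
  propB C w m -> propBc w m.
Proof.
move=> pm pb H j jw b; have := H j jw.
rewrite propB_prod // -prodroots_neighbours -prodroots_cons !PjE -prodroots_cat.
have mE : factors m j = m j by rewrite /factors; case: j jw.
have jw1 : (1 <= j <= (size w).+1)%N by lia.
rewrite mE => /(prodroots_inj HC) E.
have /permP/(_ (pred1 b)) : perm_eq (m j ++ last_factors w m j (letter w j))
    (beta C w j :: neighbours w m j).
  apply: E => c.
    rewrite mem_cat => /orP[|]; [exact: pm|exact: (posroots_last pm jw1)].
  rewrite in_cons => /orP[/eqP->|]; first exact: pb.
  move=> /flattenP[t /mapP[r _ ->]]; exact: (posroots_last pm jw1).
by rewrite count_cat /= count_neighbours.
Qed.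

(** (C) indexed by the later of two consecutive occurrences; a first occurrence is compared with the
    empty list and gives a trivial bound. *)
Definition propCc w m := forall j i, (1 <= j <= size w)%N -> (1 <= i <= size w)%N ->
  (count_mem (beta C w i) (last_factors w m j (letter w j)) <=
   (count_mem (beta C w i) (m j)).+1)%N.

Lemma propC_propCc w m : propC C w m -> propCc w m.
Proof.
move=> H j i jw iw; rewrite /last_factors.
have [->|l0] := posnP (lastp w j (letter w j)); first by [].
have := H (lastp w j (letter w j)) i; rewrite jplus_of_lastp // /factors.
rewrite -[_ == 0%N]negbK -lt0n l0 /= => H'.
have := lastp_lt w (letter w j) (proj1 (andP jw)) => lj.
have jex : in_Jex w (lastp w j (letter w j)) by rewrite /in_Jex jplus_of_lastp //; lia.
by have := H' jex iw; case: (j) jw => // j' _; lia.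
Qed.

Lemma propCc_propC w m : propCc w m -> propC C w m.
Proof.
move=> H j i /andP[jw jpw] iw; have gt := jplus_gt w j.
have := H (jplus w j) i; rewrite /last_factors lastp_jplus // /factors.
have -> : (j == 0%N) = false by case: j jw {jpw gt}.
have jw1 : (0 < jplus w j <= size w)%N by lia.
by move=> /(_ jw1 iw); lia.
Qed.

(** Letters after the last occurrence of [r] act first and fix the fundamental weight of [r], so
    they can be skipped. *)
Lemma last_Dbar w m j r : propA C w m -> (1 <= j <= (size w).+1)%N ->
  Dbar_minor C (take j.-1 w) (fund_weight r) =
  (tofracA (prodroots (last_factors w m j r)))^-1.
Proof.
move=> H; case: j => // j /andP[_]; elim: j => [_|j IHj jw].
  rewrite take0 Dbar_minor_nil // /last_factors lastp1 /factors /prodroots big_nil.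
  by rewrite tofracA1 invr1.
rewrite last_factorsS //; case: eqP => [<-|nr]; first by have [_ <-] := H j.+1 jw.
rewrite -IHj ?(ltnW jw) //= (take_nth ord0) // -/(letter w j.+1) -cats1.
rewrite -[in RHS](cats0 (take j w)); apply: Dbar_minor_skip => //=.
by rewrite fund_weightE; case: eqP.
Qed.

Lemma posroot_beta w j : reduced_word C w -> (1 <= j <= size w)%N -> is_posroot C (beta C w j).
Proof.
move=> rw jw; split; first by exists (take j.-1 w), (letter w j).
apply: (reduced_rcons_nonneg HC).
rewrite -[w](cat_take_drop j) in rw; move/reduced_cat_l: rw.
by case: j jw => // j jw; rewrite (take_nth ord0).
Qed.

(** After cancelling the common prefix, equality would make the last root of a reduced factor of [w]
    equal to the negative of a simple root. *)
Lemma beta_neq w i j : reduced_word C w -> (1 <= i < j)%N -> (j <= size w)%N ->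
  beta C w i != beta C w j.
Proof.
case: i => // i; case: j => // j rw /andP[_ ij] jw; rewrite /beta /=.
have E : take j w = take i w ++ letter w i.+1 :: take (j - i.+1) (drop i.+1 w).
  rewrite -[in LHS](cat_take_drop i w) take_cat size_take.
  have iw : (i < size w)%N by lia.
  rewrite iw ifN -?leqNgt; last lia.
  rewrite (drop_nth ord0 iw) -/(letter w i.+1).
  by have -> : (j - i = (j - i.+1).+1)%N by lia.
set s := take (j - i.+1) _ in E; rewrite E ract_cat; apply/eqP => /(can_inj (ractK HC _)) /= H.
have rs : reduced_word C (rcons s (letter w j.+1)).
  rewrite -[w](cat_take_drop j.+1) in rw; move/reduced_cat_l: rw.
  rewrite (take_nth ord0) // E -/(letter w j.+1) rcons_cat rcons_cons -cat_rcons.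
  exact: reduced_cat_r.
have := reduced_rcons_nonneg HC rs (letter w i.+1).
have := congr1 (sref C (letter w i.+1)) H; rewrite srefK // => <-.
by rewrite srefE !simple_rootE eqxx rpair_simple cartan_diag.
Qed.

(** By (B), a factor of [P_j] is [beta_j] or divides some earlier [P_l]. *)
Lemma support w m j b : propBc w m -> (1 <= j <= size w)%N -> b \in m j ->
  exists2 i, (1 <= i <= j)%N & b = beta C w i.
Proof.
move=> H; elim/ltn_ind: j => j IHj jw bj.
have := H j jw b; have c0 : (0 < count_mem b (m j))%N by rewrite -has_count has_pred1.
have [<- _|_] := eqVneq (beta C w j) b; first by exists j => //; lia.
rewrite add0n => E; have : (0 < \sum_(r | C r (letter w j) == -1%R)
    count_mem b (last_factors w m j r))%N by rewrite -E addn_gt0 c0.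
rewrite lt0n sum_nat_eq0 negb_forall => /existsP[r]; rewrite negb_imply => /andP[_].
rewrite -lt0n -has_count has_pred1 /last_factors /factors; case: eqP => // l0 bl.
have lj := lastp_lt w r (proj1 (andP jw)).
have lw : (1 <= lastp w j r <= size w)%N by lia.
have [i ij ->] := IHj _ lj lw bl.
by exists i => //; lia.
Qed.

Lemma count_eq0_later w m i j r : reduced_word C w -> propBc w m ->
  (1 <= j <= i)%N -> (i <= size w)%N ->
  count_mem (beta C w i) (last_factors w m j r) = 0%N.
Proof.
move=> rw H ji iw; apply/eqP; rewrite -leqn0 leqNgt -has_count has_pred1.
apply/negP; rewrite /last_factors /factors; case: eqP => // l0.
have lj := lastp_lt w r (proj1 (andP ji)).
move=> /(support H) [|i' i'l E]; first lia.
by have := @beta_neq w i' i rw; rewrite E eqxx; lia.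
Qed.

End Counts.

(** * The braid move *)

Section BraidMultiplicities.
(** For a fixed root [b]: [x, y, z] are its multiplicities in [P_k, P_(k+1), P_(k+2)], and [ap, aq]
    those in [Q_p, Q_q]. The booleans tell whether [b] is [beta_k], [beta_(k+1)], [beta_(k+2)]. The
    contributions of the other neighbours of [p] and of [q] are [s] and [t]. Then [e1] to [e3] are
    (B), and [c1] to [c3] are (C). *)
Variables (b0 b1 b2 : bool) (x y z ap aq s t : nat).
Hypotheses (e1 : (x + ap = b0 + (aq + s))%N) (e2 : (y + aq = b1 + (x + t))%N)
  (e3 : (z + x = b2 + (y + s))%N).
Hypotheses (c1 : (ap <= x.+1)%N) (c2 : (aq <= y.+1)%N) (c3 : (x <= z.+1)%N).
Hypothesis excl : [\/ [/\ b0 = false, b1 = false & b2 = false],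
  [/\ b0, b1 = false, b2 = false, ap = 0%N & aq = 0%N],
  [/\ b0 = false, b1, b2 = false, ap = 0%N & aq = 0%N] /\ x = 0%N |
  [/\ b0 = false, b1 = false, b2, ap = 0%N & aq = 0%N] /\ x = 0%N /\ y = 0%N].

(** Away from the three roots, failure forces [aq = 0] and [x = z + 1] by [c3]; then [e1] and [e3]
    give [y = z - ap], against [y >= x] from [e2]. For [b = beta_(k+1)], [e2] gives [y >= 1] and
    [e3] gives [z >= y]. *)
Lemma exchange_subset : (b1 + x <= b0 + (z + aq))%N.
Proof using All.
by case: excl => [[]|[]|[[] + + + + +]|[[] + + + + + []]] *; subst; lia.
Qed.

(** With [r] the multiplicity in [P'_k], the first three equations are (B) for the new word at [k],
    [k+1], [k+2]. The last one, [beta_(k+2) Q_p P_(k+1) = beta_k P_(k+2) Q_q], is the common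
    denominator needed to add the two reciprocals. *)
Lemma exchange_B r : (r + (b1 + x) = b0 + (z + aq))%N ->
  [/\ (r + aq = b2 + (ap + t))%N, (z + ap = b1 + (r + s))%N, (y + r = b0 + (z + t))%N &
      (b2 + (ap + y) = b0 + (z + aq))%N].
Proof using e1 e2 e3. by clear c1 c2 c3 excl; split; lia. Qed.

(** (C) for the new word, comparing [Q_q] with [P'_k], [Q_p] with [P'_(k+1)], and [P'_k] with
    [P'_(k+2)]. *)
Lemma exchange_C r : (r + (b1 + x) = b0 + (z + aq))%N ->
  [/\ (aq <= r.+1)%N, (ap <= z.+1)%N & (r <= y.+1)%N].
Proof using All.
by case: excl => [[]|[]|[[] + + + + +]|[[] + + + + + []]] *; subst; split; lia.
Qed.

End BraidMultiplicities.

Section BraidMove.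
Variables (n : nat) (C : 'M[int]_n.+1).
Hypothesis HC : simply_laced_simple_cartan C.

(** Division of products of roots. It truncates silently, and is exact here by [exchange_subset]. *)
Definition multiset_sub (s t : seq (rootv n)) := foldr (fun b s' => rem b s') s t.

Lemma count_multiset_sub b s t : count_mem b (multiset_sub s t) = (count_mem b s - count_mem b t)%N.
Proof.
elim: t => [|c t IHt] /=; first by rewrite subn0.
by rewrite count_mem_rem IHt addnC subnDA.
Qed.

Lemma mem_multiset_sub s t : {subset multiset_sub s t <= s}.
Proof. by elim: t => //= c t IHt b /mem_rem; apply: IHt. Qed.

(** The right side of the exchange relation is [(B2 + B0) / (B0 Z Pq)], whose numerator is the
    single root [B1]. *)
Lemma exchange_value (F : fieldType) (D X Y Z Pp Pq PR B0 B1 B2 : F) :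
  X != 0 -> Y != 0 -> Z != 0 -> Pp != 0 -> Pq != 0 -> B0 != 0 -> B1 != 0 -> B2 != 0 ->
  X^-1 * D = Pp^-1 * Y^-1 + Z^-1 * Pq^-1 ->
  B2 * (Pp * Y) = B0 * (Z * Pq) -> PR * (B1 * X) = B0 * (Z * Pq) -> B1 = B0 + B2 ->
  D = PR^-1.
Proof.
move=> X0 Y0 Z0 Pp0 Pq0 B00 B10 B20 ED EY ER E1.
have -> : D = X * (X^-1 * D) by rewrite mulVKf.
have -> : PR = B0 * (Z * Pq) / (B1 * X) by rewrite -ER mulfK // mulf_neq0.
have -> : X * (X^-1 * D) = X * ((Pp * Y)^-1 + Z^-1 * Pq^-1) by rewrite ED invfM.
have -> : Pp * Y = B0 * (Z * Pq) / B2 by rewrite -EY mulrAC divff ?mul1r.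
by rewrite E1; field; rewrite -E1 X0 B00 B10 B20 Z0 Pq0.
Qed.

Variables (v u : seq 'I_n.+1) (p q : 'I_n.+1).
Hypothesis Cpq : C p q = -1.
Notation w := (v ++ [:: p; q; p] ++ u).
Notation w' := (v ++ [:: q; p; q] ++ u).
Notation k := (size v).+1.
Hypotheses (rw : reduced_word C w) (rw' : reduced_word C w').
Variable m : nat -> seq (rootv n).
Hypotheses (mA : propA C w m) (mB : propB C w m) (mC : propC C w m).

Let Cqp : C q p = -1.
Proof. by rewrite (cartan_sym HC). Qed.

Let pq : p != q.
Proof. exact: (cartan_adj_neq HC Cpq). Qed.

Let qp : (q == p) = false.
Proof. by rewrite eq_sym (negPf pq). Qed.

Let take_at a s : take (size v + a) (v ++ s) = v ++ take a s.
Proof. by rewrite takeD take_size_cat // drop_size_cat. Qed.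

Let letter_at a (s : seq 'I_n.+1) : letter (v ++ s) (size v + a).+1 = nth ord0 s a.
Proof. by rewrite /letter /= nth_cat ltnNge leq_addr /= addKn. Qed.

Let lk (a b c : 'I_n.+1) : letter (v ++ [:: a; b; c] ++ u) k = a.
Proof. by have := letter_at 0 ([:: a; b; c] ++ u); rewrite addn0. Qed.

Let lk1 (a b c : 'I_n.+1) : letter (v ++ [:: a; b; c] ++ u) k.+1 = b.
Proof. by have := letter_at 1 ([:: a; b; c] ++ u); rewrite addn1. Qed.

Let lk2 (a b c : 'I_n.+1) : letter (v ++ [:: a; b; c] ++ u) k.+2 = c.
Proof. by have := letter_at 2 ([:: a; b; c] ++ u); rewrite addn2. Qed.

Let size_w : size w = (size v + 3 + size u)%N.
Proof. by rewrite !size_cat /= addnA. Qed.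

Let size_w' : size w' = (size v + 3 + size u)%N.
Proof. by rewrite !size_cat /= addnA. Qed.

Let letter_low (a b c : 'I_n.+1) j : (1 <= j < k)%N ->
  letter (v ++ [:: a; b; c] ++ u) j = letter v j.
Proof.
move=> jk; rewrite /letter nth_cat; have -> : (j.-1 < size v)%N by lia.
by [].
Qed.

Let letter_high j : (k.+2 < j)%N -> letter w' j = letter w j.
Proof.
move=> jk; have -> : j = (size v + (j - (size v).+1)).+1 by lia.
have : (3 <= j - (size v).+1)%N by lia.
by rewrite !letter_at; case: (j - (size v).+1)%N => [|[|[|a]]].
Qed.

Let take_low (a b c : 'I_n.+1) j : (j < k)%N -> take j (v ++ [:: a; b; c] ++ u) = take j v.
Proof.
by rewrite ltnS leq_eqVlt take_cat => /orP[/eqP->|->//]; rewrite ltnn subnn take_size cats0.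
Qed.

Let take_high (a b c : 'I_n.+1) j : (k.+2 <= j)%N ->
  take j (v ++ [:: a; b; c] ++ u) = v ++ [:: a; b; c] ++ take (j - size v - 3) u.
Proof.
move=> jk; have {1}-> : j = (size v + (j - size v - 3).+3)%N by lia.
by rewrite take_at.
Qed.

Let pm : all_posroots C w m.
Proof. by move=> j /mA[]. Qed.

Let Bc : propBc C w m.
Proof. by apply: (propB_propBc HC pm) mB => j; apply: posroot_beta. Qed.

Let Cc : propCc C w m.
Proof. exact: propC_propCc mC. Qed.

Notation bet := (beta C w).
Notation S := (last_factors w m).

Definition exchanged := multiset_sub (bet k :: m k.+2 ++ S k q) (bet k.+1 :: m k).

Definition braid_factors j :=
  if j == k then exchanged else if j == k.+1 then m k.+2
  else if j == k.+2 then m k.+1 else m j.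

Notation m' := braid_factors.
Notation S' := (last_factors w' m').

Let mk : m' k = exchanged.
Proof. by rewrite /m' eqxx. Qed.

Let mk1 : m' k.+1 = m k.+2.
Proof. by rewrite /m' eqxx; case: eqP => //; lia. Qed.

Let mk2 : m' k.+2 = m k.+1.
Proof. by rewrite /m' eqxx; do 2?[case: eqP => //; first lia]. Qed.

Let m_other j : (j < k)%N || (k.+2 < j)%N -> m' j = m j.
Proof. by move=> jk; rewrite /m'; do 3?[case: eqP => //; first lia]. Qed.

Let S_low j r : (1 <= j <= k)%N -> S' j r = S j r.
Proof.
elim: j => [//|[|j] IHj] jk; first by rewrite /last_factors !lastp1.
rewrite [S' j.+2 r]last_factorsS // [S j.+2 r]last_factorsS // IHj ?m_other; try lia.
by rewrite !letter_low //; lia.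
Qed.

Let Sk1 r : S k.+1 r = if p == r then m k else S k r.
Proof. by rewrite last_factorsS // lk. Qed.

Let Sk2 r : S k.+2 r = if q == r then m k.+1 else S k.+1 r.
Proof. by rewrite last_factorsS // lk1. Qed.

Let S'k r : S' k r = S k r.
Proof. by rewrite S_low //; lia. Qed.

Let S'k1 r : S' k.+1 r = if q == r then exchanged else S k r.
Proof. by rewrite last_factorsS // lk mk S'k. Qed.

Let S'k2 r : S' k.+2 r = if p == r then m k.+2 else S' k.+1 r.
Proof. by rewrite last_factorsS // lk1 mk1. Qed.

(** Past the braid both words have met the same last variables: [P_(k+2)] for [p] and [P_(k+1)] for
    [q], in swapped positions. *)
Let S_high j r : (k.+2 < j)%N -> S' j r = S j r.
Proof.
elim: j => // j IHj; rewrite ltnS leq_eqVlt => /orP[/eqP<-|jk].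
  rewrite [S' k.+3 r]last_factorsS // [S k.+3 r]last_factorsS //.
  rewrite !lk2 mk2 S'k2 S'k1 Sk2 Sk1.
  by case: (eqVneq q r) => [<-|_]; case: (eqVneq p _) => // E; move: pq; rewrite E eqxx.
rewrite [S' j.+1 r]last_factorsS 1?[S j.+1 r]last_factorsS ?IHj ?m_other ?letter_high //; lia.
Qed.

(** The roots at the braid are the images under [v] of [alpha_p], [alpha_p + alpha_q], [alpha_q];
    the new word lists them in reverse order. *)
Let bk : bet k = ract C v (simple_root p).
Proof. by rewrite /beta lk /= take_size_cat. Qed.

Let sref_adj i j : C i j = -1 -> sref C j (simple_root i) = simple_root i + simple_root j.
Proof.
move=> Cij; apply/ffunP => h; rewrite srefE rpair_simple Cij !ffunE; ring.
Qed.

Let sref_self i : sref C i (simple_root i) = - simple_root i.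
Proof.
by apply/ffunP => h; rewrite srefE rpair_simple cartan_diag // !ffunE; ring.
Qed.

Let bk1 : bet k.+1 = ract C v (simple_root q + simple_root p).
Proof.
rewrite /beta lk1 /=; have := take_at 1 ([:: p; q; p] ++ u); rewrite addn1 => ->.
by rewrite ract_cat /= sref_adj.
Qed.

Let bk2 : bet k.+2 = ract C v (simple_root q).
Proof.
rewrite /beta lk2 /=; have := take_at 2 ([:: p; q; p] ++ u); rewrite addn2 => ->.
by rewrite ract_cat /= sref_adj // srefD sref_self sref_adj // addrCA addNr addr0.
Qed.

Let b'k : beta C w' k = bet k.+2.
Proof. by rewrite bk2 /beta lk /= take_size_cat. Qed.

Let b'k1 : beta C w' k.+1 = bet k.+1.
Proof.
rewrite bk1 /beta lk1 /=; have := take_at 1 ([:: q; p; q] ++ u); rewrite addn1 => ->.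
by rewrite ract_cat /= sref_adj // addrC.
Qed.

Let b'k2 : beta C w' k.+2 = bet k.
Proof.
rewrite bk /beta lk2 /=; have := take_at 2 ([:: q; p; q] ++ u); rewrite addn2 => ->.
by rewrite ract_cat /= sref_adj // srefD sref_self sref_adj // addrCA addNr addr0.
Qed.

Let b'_low j : (1 <= j < k)%N -> beta C w' j = bet j.
Proof. by move=> jk; rewrite /beta !letter_low // !take_low //; lia. Qed.

Let b'_high j : (k.+2 < j)%N -> beta C w' j = bet j.
Proof.
move=> jk; rewrite /beta letter_high // !take_high; try lia.
by rewrite !ract_cat (ract_braid HC _ Cpq).
Qed.

(** * Multiplicities at the braid *)

Notation cnt b s := (count_mem b s).
Notation rest b i j := (\sum_(r | (C r i == -1%R) && (r != j)) cnt b (S k r))%N.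

Let sum_adj (T : 'I_n.+1 -> seq (rootv n)) b i j : C j i = -1 ->
  (forall r, C r i = -1 -> r != j -> T r = S k r) ->
  (\sum_(r | C r i == -1%R) cnt b (T r) = cnt b (T j) + rest b i j)%N.
Proof.
move=> Cji TS; rewrite (bigD1 j) /=; last by rewrite Cji.
by congr (_ + _)%N; apply: eq_bigr => r /andP[/eqP Cri rj]; rewrite TS.
Qed.

Let eqn1 b : (cnt b (m k) + cnt b (S k p) =
  (bet k == b) + (cnt b (S k q) + rest b p q))%N.
Proof.
have := Bc (j := k); rewrite size_w lk => ->; last lia.
by rewrite (sum_adj _ (T := S k) Cqp).
Qed.

Let eqn2 b : (cnt b (m k.+1) + cnt b (S k q) =
  (bet k.+1 == b) + (cnt b (m k) + rest b q p))%N.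
Proof.
have := Bc (j := k.+1); rewrite size_w lk1 => /(_ _ b); rewrite Sk1 (negPf pq) => ->; last lia.
rewrite (sum_adj _ Cpq) ?Sk1 ?eqxx // => r _ rp.
by rewrite Sk1 eq_sym (negPf rp).
Qed.

Let eqn3 b : (cnt b (m k.+2) + cnt b (m k) =
  (bet k.+2 == b) + (cnt b (m k.+1) + rest b p q))%N.
Proof.
have := Bc (j := k.+2); rewrite size_w lk2 => /(_ _ b).
rewrite Sk2 qp Sk1 eqxx => ->; last lia.
rewrite (sum_adj _ Cqp) ?Sk2 ?eqxx // => r Crp rq.
rewrite Sk2 eq_sym (negPf rq) Sk1; case: eqP Crp => // <-.
by rewrite cartan_diag.
Qed.

(** (C) extends from the roots [beta_i] to every [b], because other elements divide no [P_l]. *)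
Let cc j b : (1 <= j <= size w)%N -> (cnt b (S j (letter w j)) <= (cnt b (m j)).+1)%N.
Proof.
move=> jw; have [[i iw ->]|nb] := pselect (exists2 i, (1 <= i <= size w)%N & b = bet i).
  exact: Cc.
suff -> : cnt b (S j (letter w j)) = 0%N by [].
apply/eqP; rewrite -leqn0 leqNgt -has_count has_pred1; apply/negP.
rewrite /S /last_factors /factors; case: eqP => // l0 bl.
have lj := lastp_lt w (letter w j) (proj1 (andP jw)).
have lw : (1 <= lastp w j (letter w j) <= size w)%N by lia.
by have [i il E] := support Bc lw bl; apply: nb; exists i => //; lia.
Qed.

Let c1 b : (cnt b (S k p) <= (cnt b (m k)).+1)%N.
Proof. by have := @cc k b; rewrite lk; apply; rewrite size_w; lia. Qed.

Let c2 b : (cnt b (S k q) <= (cnt b (m k.+1)).+1)%N.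
Proof. by have := @cc k.+1 b; rewrite lk1 Sk1 (negPf pq); apply; rewrite size_w; lia. Qed.

Let c3 b : (cnt b (m k) <= (cnt b (m k.+2)).+1)%N.
Proof.
have := @cc k.+2 b; rewrite lk2 Sk2 qp Sk1 eqxx; apply.
by rewrite size_w; lia.
Qed.

Let x0 : bet k == bet k.+1 = false.
Proof. by apply: negbTE; apply: (beta_neq HC rw); rewrite ?size_w; lia. Qed.

Let x1 : bet k == bet k.+2 = false.
Proof. by apply: negbTE; apply: (beta_neq HC rw); rewrite ?size_w; lia. Qed.

Let x2 : bet k.+1 == bet k.+2 = false.
Proof. by apply: negbTE; apply: (beta_neq HC rw); rewrite ?size_w; lia. Qed.

Let later j i r : (1 <= j <= i)%N -> (i <= k.+2)%N -> cnt (bet i) (S j r) = 0%N.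
Proof. by move=> ji ik; apply: (count_eq0_later HC r rw Bc ji); rewrite size_w; lia. Qed.

(* By (B), [P_j] only involves [beta_1, ..., beta_j], and these roots are distinct. *)
Let excl b : [\/ [/\ bet k == b = false, bet k.+1 == b = false & bet k.+2 == b = false],
  [/\ bet k == b, bet k.+1 == b = false, bet k.+2 == b = false,
      cnt b (S k p) = 0%N & cnt b (S k q) = 0%N],
  [/\ bet k == b = false, bet k.+1 == b, bet k.+2 == b = false,
      cnt b (S k p) = 0%N & cnt b (S k q) = 0%N] /\ cnt b (m k) = 0%N |
  [/\ bet k == b = false, bet k.+1 == b = false, bet k.+2 == b,
      cnt b (S k p) = 0%N & cnt b (S k q) = 0%N] /\
      cnt b (m k) = 0%N /\ cnt b (m k.+1) = 0%N].
Proof.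
have mkE i : (k < i <= k.+2)%N -> cnt (bet i) (m k) = 0%N.
  by move=> ki; have := @later k.+1 i p; rewrite Sk1 eqxx; apply; lia.
have mk1E : cnt (bet k.+2) (m k.+1) = 0%N.
  by have := @later k.+2 k.+2 q; rewrite Sk2 eqxx; apply; lia.
have S0 i r : (k <= i <= k.+2)%N -> cnt (bet i) (S k r) = 0%N.
  by move=> /andP[ki ik]; apply: later.
have [r0 r1 r2] : [/\ (k <= k <= k.+2)%N, (k <= k.+1 <= k.+2)%N & (k <= k.+2 <= k.+2)%N].
  by split; lia.
have [<-|b0] := eqVneq (bet k) b.
  by constructor 2; rewrite !(S0 _ _ r0) !(eq_sym _ (bet k)) x0 x1.
have [<-|b1] := eqVneq (bet k.+1) b.
  by constructor 3; rewrite (eq_sym _ (bet k.+1)) x2 !(S0 _ _ r1) mkE ?leqnn ?leqnSn.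
have [<-|b2] := eqVneq (bet k.+2) b.
  by constructor 4; rewrite !(S0 _ _ r2) mk1E mkE ?leqnn ?leqnSn.
by constructor 1.
Qed.

Let count_exchanged b : (cnt b exchanged + ((bet k.+1 == b) + cnt b (m k)) =
  (bet k == b) + (cnt b (m k.+2) + cnt b (S k q)))%N.
Proof.
rewrite /exchanged count_multiset_sub /= count_cat subnK //.
exact: (exchange_subset (eqn1 b) (eqn2 b) (eqn3 b) (c1 b) (c2 b) (c3 b) (excl b)).
Qed.

Let unchanged j : (1 <= j < k)%N || (k.+2 < j)%N ->
  [/\ letter w' j = letter w j, m' j = m j, beta C w' j = bet j & forall r, S' j r = S j r].
Proof.
case/orP => jk; split.
- by rewrite !letter_low.
- by rewrite m_other //; lia.
- exact: b'_low.
- by move=> r; rewrite S_low //; lia.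
- exact: letter_high.
- by rewrite m_other // jk orbT.
- exact: b'_high.
- by move=> r; apply: S_high.
Qed.

Let position j : (1 <= j)%N -> [\/ (1 <= j < k)%N || (k.+2 < j)%N, j = k, j = k.+1 | j = k.+2].
Proof.
move=> j0; have [jk|] := ltnP j k; first by constructor 1; lia.
rewrite leq_eqVlt => /orP[/eqP->|]; first by constructor 2.
rewrite leq_eqVlt => /orP[/eqP->|]; first by constructor 3.
rewrite leq_eqVlt => /orP[/eqP->|]; first by constructor 4.
by move=> jk; constructor 1; rewrite jk orbT.
Qed.

Lemma braid_propB : propB C w' m'.
Proof.
apply: (propBc_propB HC) => j jw b; 
have [B B' B'' _] := exchange_B (eqn1 b) (eqn2 b) (eqn3 b) (count_exchanged b).
have [/unchanged[-> -> -> SE]|->|->|->] := position (proj1 (andP jw)).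
- rewrite SE; under eq_bigr do rewrite SE.
  by apply: Bc; rewrite size_w -size_w'.
- rewrite lk mk b'k S'k; under eq_bigr do rewrite S'k.
  by rewrite (sum_adj (T := S k) _ Cpq).
- rewrite lk1 mk1 b'k1 S'k1 qp (sum_adj _ Cqp) ?S'k1 ?eqxx //.
  by move=> r _ rq; rewrite S'k1 [q == r]eq_sym (negPf rq).
rewrite lk2 mk2 b'k2 S'k2 (negPf pq) S'k1 eqxx (sum_adj _ Cpq) ?S'k2 ?eqxx //.
move=> r Crq rp; rewrite S'k2 [p == r]eq_sym (negPf rp) S'k1; case: eqP Crq => // <-.
by rewrite cartan_diag.
Qed.

Lemma braid_propC : propC C w' m'.
Proof.
apply: propCc_propC => j i jw _; move: (beta C w' i) => b.
have [h h' h''] := exchange_C (eqn1 b) (eqn2 b) (eqn3 b) (c1 b) (c2 b) (c3 b) (excl b)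
  (count_exchanged b).
have [/unchanged[-> -> _ ->]|->|->|->] := position (proj1 (andP jw)).
- by apply: cc; rewrite size_w -size_w'.
- by rewrite lk mk S'k.
- by rewrite lk1 mk1 S'k1 qp.
by rewrite lk2 mk2 S'k2 (negPf pq) S'k1 eqxx.
Qed.

(** * Values of the new cluster variables *)

Let pos_exchanged : posroots C exchanged.
Proof.
move=> b /mem_multiset_sub; rewrite in_cons mem_cat => /or3P[/eqP->||].
- by apply: posroot_beta => //; rewrite size_w; lia.
- by apply: pm; rewrite size_w; lia.
by apply: (posroots_last pm); rewrite size_w; lia.
Qed.

Let Dbar_w j : (1 <= j <= size w)%N ->
  Dbar_minor C (take j w) (fund_weight (letter w j)) = (tofracA (prodroots (m j)))^-1.
Proof. by move=> /mA[]. Qed.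

Let take_k (a b c : 'I_n.+1) : take k (v ++ [:: a; b; c] ++ u) = v ++ [:: a].
Proof. by have := take_at 1 ([:: a; b; c] ++ u); rewrite addn1. Qed.

Let take_k1 (a b c : 'I_n.+1) : take k.+1 (v ++ [:: a; b; c] ++ u) = v ++ [:: a; b].
Proof. by have := take_at 2 ([:: a; b; c] ++ u); rewrite addn2 => ->. Qed.

Let take_k2 (a b c : 'I_n.+1) : take k.+2 (v ++ [:: a; b; c] ++ u) = v ++ [:: a; b; c].
Proof. by have := take_at 3 ([:: a; b; c] ++ u); rewrite addn3 => ->; rewrite /= take0. Qed.

(** [s_j s_i] applied to the fundamental weight of [i] pairs to zero with [alpha_i]. This matches
    the variable at [k+2] in one word with the variable at [k+1] in the other. *)
Let skip i j : C i j = -1 ->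
  Dbar_minor C (v ++ [:: i; j; i]) (fund_weight i) = Dbar_minor C (v ++ [:: j; i]) (fund_weight i).
Proof.
move=> Cij; have Cji : C j i = -1 by rewrite (cartan_sym HC).
apply: (Dbar_minor_skip v (x := i) (s := [:: j; i])).
have /negPf ij := cartan_adj_neq HC Cij.
by rewrite /= !wrefE !fund_weightE eqxx eq_sym ij Cij Cji (cartan_diag HC).
Qed.

Let red_v : reduced_word C (v ++ [:: p; q; p]).
Proof. by move: rw; rewrite catA; apply: reduced_cat_l. Qed.

Let red_v' : reduced_word C (v ++ [:: q; p; q]).
Proof. by move: rw'; rewrite catA; apply: reduced_cat_l. Qed.

Let Dbar_exchanged :
  Dbar_minor C (v ++ [:: q]) (fund_weight q) = (tofracA (prodroots exchanged))^-1.
Proof.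
have kw : (1 <= k <= size w)%N by rewrite size_w; lia.
have k1w : (1 <= k.+1 <= size w)%N by rewrite size_w; lia.
have k2w : (1 <= k.+2 <= size w)%N by rewrite size_w; lia.
have kw' : (1 <= k <= (size w).+1)%N by rewrite size_w; lia.
have nz s : posroots C s -> tofracA (prodroots s) != 0.
  by move=> ps; rewrite tofracA_eq0 (prodroots_neq0 HC).
have nzb j : (1 <= j <= size w)%N -> tofracA (rootpoly (bet j)) != 0.
  move=> jw; rewrite tofracA_eq0 rootpoly_neq0 // (posroot_neq0 HC) //.
  exact: posroot_beta.
have Dv r : Dbar_minor C v (fund_weight r) = (tofracA (prodroots (S k r)))^-1.
  by rewrite -(last_Dbar r mA kw') /= take_size_cat.
have E := Dbar_exchange HC Cpq red_v red_v'.
have Dk := Dbar_w kw; rewrite lk take_k in Dk.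
have Dk1 := Dbar_w k1w; rewrite lk1 take_k1 in Dk1.
have Dk2 := Dbar_w k2w; rewrite lk2 take_k2 skip // in Dk2.
rewrite Dk Dk1 Dk2 !Dv in E.
apply: (exchange_value _ _ _ _ _ _ _ _ E (B0 := tofracA (rootpoly (bet k)))
  (B1 := tofracA (rootpoly (bet k.+1))) (B2 := tofracA (rootpoly (bet k.+2)))).
all: try by [apply: nz; apply: pm | apply: nz; apply: (posroots_last pm) | apply: nzb].
- rewrite -!tofracAM -!prodroots_cat -!prodroots_cons; congr tofracA.
  apply: prodroots_count => b; rewrite /= !count_cat.
  by have [_ _ _] := exchange_B (eqn1 b) (eqn2 b) (eqn3 b) (count_exchanged b).
- rewrite -!tofracAM -!prodroots_cat -!prodroots_cons -prodroots_cat; congr tofracA.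
  apply: prodroots_count => b; rewrite /= !count_cat /=.
  exact: count_exchanged.
- by rewrite -tofracAD -rootpolyD bk bk1 bk2 -ractD addrC.
Qed.

Lemma braid_propA : propA C w' m'.
Proof.
move=> j jw'; have jw : (1 <= j <= size w)%N by rewrite size_w -size_w'.
have [jk|->|->|->] := position (proj1 (andP jw)).
- have [lE -> _ _] := unchanged jk; split; first exact: pm.
  rewrite -Dbar_w // /Dbar_x lE; case/orP: jk => jk; first by rewrite !take_low //; lia.
  (* Beyond the braid the two prefixes are different reduced words of one Weyl group element, so
     braid invariance of minors applies. *)
  rewrite !take_high; try lia.
  have Tj a b c : v ++ [:: a; b; c] ++ u =
      (v ++ [:: a; b; c] ++ take (j - size v - 3) u) ++ drop (j - size v - 3) u.
    by rewrite -!catA cat_take_drop.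
  move: rw rw'; rewrite !Tj => /reduced_cat_l/reduced_cat_r r1 /reduced_cat_l/reduced_cat_r r2.
  by symmetry; apply: (Dbar_minor_braid HC _ Cpq _ r1 r2) => i; apply: fund_weight_ge0.
- by rewrite /Dbar_x mk lk take_k; split; [exact: pos_exchanged|exact: Dbar_exchanged].
- rewrite /Dbar_x mk1 lk1 take_k1; split; first by apply: pm; rewrite size_w; lia.
  rewrite -Dbar_w ?size_w; last lia.
  by rewrite lk2 take_k2 skip.
rewrite /Dbar_x mk2 lk2 take_k2; split; first by apply: pm; rewrite size_w; lia.
rewrite -Dbar_w ?size_w; last lia.
by rewrite lk1 take_k1 skip.
Qed.

End BraidMove.

Lemma split3 (T : Type) (x0 : T) (s : seq T) i : (i.+2 < size s)%N ->
  s = take i s ++ [:: nth x0 s i; nth x0 s i.+1; nth x0 s i.+2] ++ drop i.+3 s.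
Proof.
move=> si; rewrite -[LHS](cat_take_drop i) (drop_nth x0) ?(drop_nth x0 (n := i.+1)) //; try lia.
by rewrite (drop_nth x0 (n := i.+2)).
Qed.

Lemma braid_moveE (n : nat) (C : 'M[int]_n.+1) (w w' : seq 'I_n.+1) (k : nat)
    (p q : 'I_n.+1) : braid_move C w w' k p q ->
  exists v u, [/\ w = v ++ [:: p; q; p] ++ u, w' = v ++ [:: q; p; q] ++ u & C p q = -1].
Proof.
move=> [[sw /andP[k1 kw] Cpq] [[l0 l1 l2] [[l0' l1' l2'] lo]]].
case: k k1 kw => // k _ kw in l0 l1 l2 l0' l1' l2' lo *.
have kw2 : (k.+2 < size w)%N by lia.
rewrite /letter /= in l0 l1 l2 l0' l1' l2'.
exists (take k w), (drop k.+3 w); split => //.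
  by rewrite {1}(split3 ord0 kw2) l0 l1 l2.
have kw2' : (k.+2 < size w')%N by rewrite sw.
rewrite {1}(split3 ord0 kw2').
have -> : take k w' = take k w.
  apply: (@eq_from_nth _ ord0); first by rewrite !size_take sw.
  move=> i; rewrite size_take => ik; have {}ik : (i < k)%N by move: ik; case: ifP; lia.
  rewrite !nth_take //; apply: (lo i.+1); first lia.
  by rewrite !inE; lia.
have -> : drop k.+3 w' = drop k.+3 w.
  apply: (@eq_from_nth _ ord0); first by rewrite !size_drop sw.
  move=> i; rewrite size_drop => ik; rewrite !nth_drop; apply: (lo (k.+3 + i).+1); first lia.
  by rewrite !inE; lia.
by rewrite l0' l1' l2'.
Qed.

Theorem theorem5p6 (n : nat) (C : 'M[int]_n.+1) (w w' : seq 'I_n.+1) (k : nat)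
    (p q : 'I_n.+1) :
  simply_laced_simple_cartan C ->
  red_expr_w0 C w -> red_expr_w0 C w' ->
  braid_move C w w' k p q ->
  (exists m : nat -> seq (rootv n), [/\ propA C w m, propB C w m & propC C w m]) ->
  exists m' : nat -> seq (rootv n), [/\ propA C w' m', propB C w' m' & propC C w' m'].
Proof.
move=> HC [rw _] [rw' _] /braid_moveE[v [u [wE wE' Cpq]]] [m [mA mB mC]].
move: rw rw' mA mB mC; rewrite wE wE' => rw rw' mA mB mC.
exists (braid_factors C v u p q m); split.
- exact: braid_propA.
- exact: braid_propB.
- exact: braid_propC.
Qed.
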